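(* Let $K$ be a field of characteristic $0$. For every fixed number of nodes $\delta\ge0$ there are polynomials $P,Q\in\mathbb{Q}[d]$ of degree $2\delta$ such that for all sufficiently large $d$ we have $$N^\delta_{\mathbb{A}^1}(d)=P(d)\,\mathbb{H}+Q(d)\,\langle1\rangle\in\mathrm{GW}(K).$$
   Context: $\mathrm{GW}(K)$ is the Grothendieck–Witt ring of $K$, $\langle c\rangle$ the class of the form $(x,y)\mapsto cxy$ on $K$, $\mathbb{H}=\langle1\rangle+\langle-1\rangle$. For $\delta=0$ the zero polynomial is regarded as having degree $0$. Floor diagrams of degree $d$. A floor diagram $\mathcal{D}=(\Gamma,w)$ of degree $d$ is a (not necessarily connected) graph $\Gamma$ without loops (multiple edges allowed) on the vertex set $\{1,\dots,d\}$, each edge oriented towards its larger vertex, with weights $w:E(\Gamma)\to\mathbb{Z}_{\ge1}$, such that at every vertex $v$ the divergence $\mathrm{div}(v)=\sum_{\text{incoming }e}w(e)-\sum_{\text{outgoing }e}w(e)$ is at most $1$. They are considered up to weight-preserving isomorphism fixing the vertices. The genus is $g(\mathcal{D})=1-d+\#E(\Gamma)$ (the first Betti number if connected), and the cogenus is $\delta(\mathcal{D})=\frac{(d-1)(d-2)}2-g(\mathcal{D})$. Markings. A marking of $\mathcal{D}$ arises as follows. Call the vertices of $\mathcal{D}$ white. (1) Subdivide each edge of $\mathcal{D}$ by a black vertex; both new edges inherit weight and orientation. (2) Add $d$ black vertices, each with one edge of weight 1 from it to some white vertex, such that in the end every white vertex has divergence exactly $1$. (3) Extend the total order on white vertices to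 a total order on all vertices compatible with the orientation of the edges. Two markings are equivalent if there is an isomorphism of the underlying graphs respecting weights and total orders and fixing the white vertices. $\nu(\mathcal{D})$ is the number of markings up to equivalence. Multiplicity and count. An edge $e$ of weight $w$ has $\mathrm{mult}_{\mathbb{A}^1}(e)=\frac{w-1}{2}\mathbb{H}+\langle w\rangle$ if $w$ is odd and $\frac w2\mathbb{H}$ if $w$ is even. $\mathrm{mult}_{\mathbb{A}^1}(\mathcal{D})$ is the product of $\mathrm{mult}_{\mathbb{A}^1}(e)$ over all edges $e$ of a marking of $\mathcal{D}$, i.e. $\prod_{e\in E(\Gamma)}\mathrm{mult}_{\mathbb{A}^1}(e)^2$. Then $N^\delta_{\mathbb{A}^1}(d)=\sum_{\mathcal{D}}\mathrm{mult}_{\mathbb{A}^1}(\mathcal{D})\,\nu(\mathcal{D})$, summed over all floor diagrams of degree $d$ and cogenus $\delta$. *)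

(* Defs.v *)
From HB Require Import structures.
From mathcomp Require Import all_boot all_order all_algebra.
From mathcomp Require Import perm mxtens.
From mathcomp Require Import finmap boolp classical_sets functions cardinality fsbigop.
From mathcomp Require Import ring zify.

Set Implicit Arguments.
Unset Strict Implicit.
Unset Printing Implicit Defensive.

Import Order.TTheory GRing.Theory Num.Theory.
Local Open Scope quotient_scope.
Local Open Scope ring_scope.

Section Forms.
Variable K : fieldType.

(* A nondegenerate symmetric bilinear form on K^n, given by its Gram matrix. *)
Definition is_form (F : {n : nat & 'M[K]_n}) : bool :=
  ((tagged F)^T == tagged F) && (tagged F \in unitmx).

Record form := Form { form_val : {n : nat & 'M[K]_n}; _ : is_form form_val }.

HB.instance Definition _ := [isSub for form_val].
HB.instance Definition _ := [Choice of form by <:].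

Definition fdim (F : form) : nat := tag (val F).
Definition gram (F : form) : 'M[K]_(fdim F) := tagged (val F).

Lemma gram_sym (F : form) : (gram F)^T = gram F.
Proof. by have /andP[/eqP] := valP F. Qed.

Lemma gram_unit (F : form) : gram F \in unitmx.
Proof. by have /andP[] := valP F. Qed.

Definition mkform n (A : 'M[K]_n) (As : A^T = A) (Au : A \in unitmx) : form :=
  @Form (Tagged (fun n => 'M[K]_n) A)
    (introT andP (conj (introT eqP As) Au)).

(* An isometry is an invertible K-linear map K^m -> K^n (v |-> v *m P)
   compatible with the forms; m = n is then automatic (isom_mx_dim). *)
Definition isom_mx m n (A : 'M[K]_m) (B : 'M[K]_n) : Prop :=
  exists (P : 'M[K]_(m, n)) (Q : 'M[K]_(n, m)),
    [/\ P *m Q = 1%:M, Q *m P = 1%:M & P *m B *m P^T = A].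

Definition isometric (F G : form) : Prop := isom_mx (gram F) (gram G).

Lemma isom_mx_refl m (A : 'M[K]_m) : isom_mx A A.
Proof. by exists 1%:M, 1%:M; split; rewrite ?mulmx1 // mul1mx trmx1 mulmx1. Qed.

Lemma isom_mx_sym m n (A : 'M[K]_m) (B : 'M[K]_n) : isom_mx A B -> isom_mx B A.
Proof.
move=> [P [Q [PQ QP <-]]]; exists Q, P; split=> //.
by rewrite !mulmxA QP mul1mx -mulmxA -trmx_mul QP trmx1 mulmx1.
Qed.

Lemma isom_mx_trans m n p (B : 'M[K]_n) (A : 'M[K]_m) (C : 'M[K]_p) :
  isom_mx A B -> isom_mx B C -> isom_mx A C.
Proof.
move=> [P [Q [PQ QP <-]]] [P' [Q' [PQ' QP' <-]]].
exists (P *m P'), (Q' *m Q); split.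
- by rewrite mulmxA -(mulmxA P) PQ' mulmx1.
- by rewrite mulmxA -(mulmxA Q') QP mulmx1.
- by rewrite trmx_mul !mulmxA.
Qed.

Lemma isom_mx_inj m n (A : 'M[K]_m) (B : 'M[K]_n) (f : 'I_m -> 'I_n) :
  m = n -> injective f -> (forall i j, A i j = B (f i) (f j)) -> isom_mx A B.
Proof.
move=> mn fI AB; have fb : bijective f by apply: inj_card_bij; rewrite ?card_ord ?mn.
case: fb => g fK gK.
have key (P := \matrix_(i, j) (f i == j)%:R : 'M[K]_(m, n)) p (C : 'M[K]_(n, p)) i j :
    (P *m C) i j = C (f i) j.
  rewrite mxE (bigD1 (f i)) //= big1 ?addr0 => [|k kN]; first by rewrite mxE eqxx mul1r.
  by rewrite mxE eq_sym (negPf kN) mul0r.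
exists (\matrix_(i, j) (f i == j)%:R), (\matrix_(i, j) (g i == j)%:R); split.
- by apply/matrixP=> i j; rewrite key !mxE fK.
- apply/matrixP=> i j; rewrite !mxE (bigD1 (g i)) //= big1 ?addr0 => [|k kN].
    by rewrite !mxE eqxx mul1r gK.
  by rewrite !mxE eq_sym (negPf kN) mul0r.
- apply/matrixP=> i j; rewrite AB -mulmxA key.
  set P := \matrix_(k, l) _.
  have -> : B *m P^T = (P *m B^T)^T by rewrite trmx_mul trmxK.
  by rewrite mxE key mxE.
Qed.

Lemma isom_mx_cast m n (e : m = n) (A : 'M[K]_m) : isom_mx (castmx (e, e) A) A.
Proof. by case: n / e; rewrite castmx_id; apply: isom_mx_refl. Qed.

Lemma isom_mx_dim m n (A : 'M[K]_m) (B : 'M[K]_n) : isom_mx A B -> m = n.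
Proof.
move=> [P [Q [PQ QP _]]]; apply/eqP; rewrite eqn_leq; apply/andP; split.
- by rewrite -{1}(mxrank1 K m) -PQ (leq_trans (mxrankM_maxl _ _)) ?rank_leq_col.
- by rewrite -{1}(mxrank1 K n) -QP (leq_trans (mxrankM_maxl _ _)) ?rank_leq_col.
Qed.

Lemma zero_subproof : (1%:M : 'M[K]_0)^T = 1%:M. Proof. exact: trmx1. Qed.
Definition form0 : form := mkform zero_subproof (unitmx1 K 0).

Lemma one_subproof : (1%:M : 'M[K]_1)^T = 1%:M. Proof. exact: trmx1. Qed.
Definition form1 : form := mkform one_subproof (unitmx1 K 1).

Lemma formD_sym (F G : form) :
  (block_mx (gram F) 0 0 (gram G))^T = block_mx (gram F) 0 0 (gram G).
Proof. by rewrite tr_block_mx !gram_sym !trmx0. Qed.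
Lemma formD_unit (F G : form) : block_mx (gram F) 0 0 (gram G) \in unitmx.
Proof. by rewrite unitmxE det_ublock unitrM -!unitmxE !gram_unit. Qed.
(* Orthogonal sum. *)
Definition formD (F G : form) : form := mkform (formD_sym F G) (formD_unit F G).

Lemma formM_sym (F G : form) :
  (gram F *t gram G)^T = gram F *t gram G.
Proof. by rewrite trmx_tens !gram_sym. Qed.

Lemma mxtens_index_inj m n (i k : 'I_m) (j l : 'I_n) :
  mxtens_index (i, j) = mxtens_index (k, l) -> i = k /\ j = l.
Proof. by move=> /(can_inj (@mxtens_indexK m n)) H; split; case: H. Qed.

Lemma tens1mx1 m n : (1%:M : 'M[K]_m) *t (1%:M : 'M[K]_n) = 1%:M.
Proof.
apply/matrixP=> i j; case: (mxtens_indexP i) => a b; case: (mxtens_indexP j) => c d.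
rewrite tensmxE !mxE (can_eq (@mxtens_indexK _ _)) xpair_eqE.
by case: (a == c); rewrite ?mul1r ?mul0r.
Qed.

Lemma formM_unit (F G : form) : gram F *t gram G \in unitmx.
Proof.
have : (gram F *t gram G) *m (invmx (gram F) *t invmx (gram G)) = 1%:M.
  by rewrite tensmx_mul !mulmxV ?gram_unit // tens1mx1.
by case/mulmx1_unit.
Qed.
(* Tensor product. *)
Definition formM (F G : form) : form := mkform (formM_sym F G) (formM_unit F G).

Lemma isom_mx_block m m' n n' (A : 'M[K]_m) (A' : 'M_m') (B : 'M_n) (B' : 'M_n') :
  isom_mx A A' -> isom_mx B B' ->
  isom_mx (block_mx A 0 0 B) (block_mx A' 0 0 B').
Proof.
move=> [P [Q [PQ QP <-]]] [P' [Q' [PQ' QP' <-]]].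
exists (block_mx P 0 0 P'), (block_mx Q 0 0 Q'); split;
  rewrite ?tr_block_mx ?trmx0 !mulmx_block ?(mulmx0, mul0mx, addr0, add0r) //.
- by rewrite PQ PQ' -scalar_mx_block.
- by rewrite QP QP' -scalar_mx_block.
Qed.

Lemma isom_mx_tens m m' n n' (A : 'M[K]_m) (A' : 'M_m') (B : 'M_n) (B' : 'M_n') :
  isom_mx A A' -> isom_mx B B' -> isom_mx (A *t B) (A' *t B').
Proof.
move=> [P [Q [PQ QP <-]]] [P' [Q' [PQ' QP' <-]]].
exists (P *t P'), (Q *t Q'); rewrite trmx_tens !tensmx_mul; split=> //.
- by rewrite PQ PQ' tens1mx1.
- by rewrite QP QP' tens1mx1.
Qed.

Lemma isom_mx_blockA m n p (A : 'M[K]_m) (B : 'M_n) (C : 'M_p) :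
  isom_mx (block_mx A 0 0 (block_mx B 0 0 C)) (block_mx (block_mx A 0 0 B) 0 0 C).
Proof.
have := @block_mxA _ m n p m n p A 0 0 0 B 0 0 0 C.
rewrite /= !row_mx0 !col_mx0 => ->; exact: isom_mx_cast.
Qed.

Lemma isom_mx_blockC m n (A : 'M[K]_m) (B : 'M_n) :
  isom_mx (block_mx A 0 0 B) (block_mx B 0 0 A).
Proof.
exists (block_mx 0 1%:M 1%:M 0), (block_mx 0 1%:M 1%:M 0); split;
  rewrite ?tr_block_mx ?trmx0 ?trmx1 !mulmx_block
    ?(mulmx0, mul0mx, addr0, add0r, mulmx1, mul1mx) // -scalar_mx_block //.
Qed.

Lemma isom_mx_block0 m (A : 'M[K]_m) (Z : 'M[K]_0) :
  isom_mx (block_mx Z 0 0 A) A.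
Proof.
apply/isom_mx_sym/(isom_mx_inj (f := @rshift 0 m)) => //; first exact: rshift_inj.
by move=> i j; rewrite block_mxEdr.
Qed.

Lemma isom_mx_tensA m n p (A : 'M[K]_m) (B : 'M_n) (C : 'M_p) :
  isom_mx (A *t (B *t C)) (A *t B *t C).
Proof.
pose f (i : 'I_(m * (n * p))) : 'I_(m * n * p) :=
  let a := mxtens_unindex i in let b := mxtens_unindex a.2 in
  mxtens_index (mxtens_index (a.1, b.1), b.2).
have fE a b c : f (mxtens_index (a, mxtens_index (b, c))) =
    mxtens_index (mxtens_index (a, b), c) by rewrite /f !mxtens_indexK.
apply: (isom_mx_inj (f := f)) => [||i j]; first exact: mulnA.
- move=> i j; case: (mxtens_indexP i) => a i'; case: (mxtens_indexP i') => b c.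
  case: (mxtens_indexP j) => a' j'; case: (mxtens_indexP j') => b' c'.
  rewrite !fE => /mxtens_index_inj[].
  by move=> /mxtens_index_inj[-> ->] ->.
- case: (mxtens_indexP i) => a i'; case: (mxtens_indexP i') => b c.
  case: (mxtens_indexP j) => a' j'; case: (mxtens_indexP j') => b' c'.
  by rewrite !fE !tensmxE mulrA.
Qed.

Lemma isom_mx_tensC m n (A : 'M[K]_m) (B : 'M_n) : isom_mx (A *t B) (B *t A).
Proof.
pose f (i : 'I_(m * n)) : 'I_(n * m) :=
  mxtens_index ((mxtens_unindex i).2, (mxtens_unindex i).1).
have fE a b : f (mxtens_index (a, b)) = mxtens_index (b, a)
  by rewrite /f !mxtens_indexK.
apply: (isom_mx_inj (f := f)) => [||i j]; first exact: mulnC.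
- move=> i j; case: (mxtens_indexP i) => a b; case: (mxtens_indexP j) => c d.
  by rewrite !fE => /mxtens_index_inj[-> ->].
- case: (mxtens_indexP i) => a b; case: (mxtens_indexP j) => c d.
  by rewrite !fE !tensmxE mulrC.
Qed.

Lemma isom_mx_tens1 m (A : 'M[K]_m) : isom_mx ((1%:M : 'M_1) *t A) A.
Proof. by rewrite tens_scalar1mx; apply: isom_mx_cast. Qed.

Lemma isom_mx_tensD m n p (A : 'M[K]_m) (B : 'M_n) (C : 'M_p) :
  isom_mx (block_mx A 0 0 B *t C) (block_mx (A *t C) 0 0 (B *t C)).
Proof.
pose f (i : 'I_((m + n) * p)) : 'I_(m * p + n * p) :=
  let a := mxtens_unindex i in
  match fintype.split a.1 with
  | inl b => lshift _ (mxtens_index (b, a.2))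
  | inr b => rshift _ (mxtens_index (b, a.2))
  end.
have fl a b : f (mxtens_index (lshift _ a, b)) = lshift _ (mxtens_index (a, b)).
  by rewrite /f mxtens_indexK (unsplitK (inl a)).
have fr a b : f (mxtens_index (rshift _ a, b)) = rshift _ (mxtens_index (a, b)).
  by rewrite /f mxtens_indexK (unsplitK (inr a)).
apply: (isom_mx_inj (f := f)) => [||i j]; first exact: mulnDl.
- move=> i j; case: (mxtens_indexP i) => a b; case: (mxtens_indexP j) => c d.
  case: (split_ordP a) => a' ->; case: (split_ordP c) => c' ->; rewrite ?fl ?fr => /eqP;
  rewrite ?(eq_lshift, eq_rshift, eq_lrshift, eq_rlshift) // => /eqP.
    by move=> /mxtens_index_inj[-> ->].
  by move=> /mxtens_index_inj[-> ->].
- case: (mxtens_indexP i) => a b; case: (mxtens_indexP j) => c d.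
  case: (split_ordP a) => a' ->; case: (split_ordP c) => c' ->; rewrite ?fl ?fr !tensmxE;
  by rewrite ?(block_mxEul, block_mxEur, block_mxEdl, block_mxEdr) ?tensmxE // !mxE mul0r.
Qed.

Lemma isom_mx_tens0 m (Z : 'M[K]_0) (A : 'M[K]_m) (Z' : 'M[K]_0) :
  isom_mx (Z *t A) Z'.
Proof. by exists 0, 0; split; apply/matrixP=> -[]. Qed.

Lemma isometric_equiv : equiv_class_of (fun F G : form => `[< isometric F G >]).
Proof.
split=> [F|F G|G F H]; first exact/asboolP/isom_mx_refl.
- by apply/asboolP/asboolP; apply: isom_mx_sym.
- by move=> /asboolP FG /asboolP GH; apply/asboolP; apply: isom_mx_trans FG GH.
Qed.

Canonical isometric_equiv_rel := EquivRelPack isometric_equiv.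

Definition isoclass := {eq_quot isometric_equiv_rel}.
HB.instance Definition _ := EqQuotient.on isoclass.
HB.instance Definition _ := Choice.on isoclass.

Definition isocl (F : form) : isoclass := \pi F.

Lemma isoclassP (F G : form) : isometric F G <-> isocl F = isocl G.
Proof. by split=> [FG|/eqmodP/asboolP//]; apply/eqmodP/asboolP. Qed.

Lemma isoclW (P : isoclass -> Prop) : (forall F, P (isocl F)) -> forall x, P x.
Proof. by move=> PF; elim/quotW. Qed.

Lemma isoclass_repr (F : form) : isometric (repr (isocl F)) F.
Proof. by apply/isoclassP; rewrite /isocl reprK. Qed.

Definition isoclassD (x y : isoclass) : isoclass :=
  isocl (formD (repr x) (repr y)).
Definition isoclassM (x y : isoclass) : isoclass :=
  isocl (formM (repr x) (repr y)).

Lemma isoclassDE (F G : form) :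
  isoclassD (isocl F) (isocl G) = isocl (formD F G).
Proof. by apply/isoclassP/isom_mx_block; apply: isoclass_repr. Qed.
Lemma isoclassME (F G : form) :
  isoclassM (isocl F) (isocl G) = isocl (formM F G).
Proof. by apply/isoclassP/isom_mx_tens; apply: isoclass_repr. Qed.

Lemma isoclassDA : associative isoclassD.
Proof.
elim/isoclW=> x; elim/isoclW=> y; elim/isoclW=> z; rewrite !isoclassDE.
exact/isoclassP/isom_mx_blockA.
Qed.
Lemma isoclassDC : commutative isoclassD.
Proof.
elim/isoclW=> x; elim/isoclW=> y; rewrite !isoclassDE.
exact/isoclassP/isom_mx_blockC.
Qed.
Lemma isoclass0D : left_id (isocl form0) isoclassD.
Proof.
elim/isoclW=> x; rewrite !isoclassDE; exact/isoclassP/isom_mx_block0.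
Qed.
Lemma isoclassMA : associative isoclassM.
Proof.
elim/isoclW=> x; elim/isoclW=> y; elim/isoclW=> z; rewrite !isoclassME.
exact/isoclassP/isom_mx_tensA.
Qed.
Lemma isoclassMC : commutative isoclassM.
Proof.
elim/isoclW=> x; elim/isoclW=> y; rewrite !isoclassME.
exact/isoclassP/isom_mx_tensC.
Qed.
Lemma isoclass1M : left_id (isocl form1) isoclassM.
Proof.
elim/isoclW=> x; rewrite !isoclassME; exact/isoclassP/isom_mx_tens1.
Qed.
Lemma isoclassMDl : left_distributive isoclassM isoclassD.
Proof.
elim/isoclW=> x; elim/isoclW=> y; elim/isoclW=> z.
rewrite [isoclassD (isocl x) _]isoclassDE !isoclassME isoclassDE.
exact/isoclassP/isom_mx_tensD.
Qed.
Lemma isoclass0M : left_zero (isocl form0) isoclassM.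
Proof.
elim/isoclW=> x; rewrite !isoclassME; exact/isoclassP/isom_mx_tens0.
Qed.

HB.instance Definition _ := GRing.isNmodule.Build isoclass
  isoclassDA isoclassDC isoclass0D.
HB.instance Definition _ := GRing.Nmodule_isComPzSemiRing.Build isoclass
  isoclassMA isoclassMC isoclass1M isoclassMDl isoclass0M.
End Forms.


Section Grothendieck.
Variable S : comPzSemiRingType.

(* Group completion of a commutative semiring: (a, b) stands for a - b. *)
Definition groth_eq (x y : S * S) : Prop :=
  exists e : S, x.1 + y.2 + e = y.1 + x.2 + e.

Lemma groth_equiv : equiv_class_of (fun x y : S * S => `[< groth_eq x y >]).
Proof.
split=> [x|x y|y x z]; first by apply/asboolP; exists 0.
- by apply/asboolP/asboolP => -[e E]; exists e; rewrite E.
- move=> /asboolP[e E] /asboolP[f E']; apply/asboolP; exists (y.1 + y.2 + e + f).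
  have -> : x.1 + z.2 + (y.1 + y.2 + e + f) = (x.1 + y.2 + e) + (y.1 + z.2 + f) by ring.
  by rewrite E E'; ring.
Qed.

Canonical groth_equiv_rel := EquivRelPack groth_equiv.

Definition groth := {eq_quot groth_equiv_rel}.
HB.instance Definition _ := EqQuotient.on groth.
HB.instance Definition _ := Choice.on groth.

Definition gdiff (a b : S) : groth := \pi_groth (a, b).

Lemma gdiffP (a b c d : S) : groth_eq (a, b) (c, d) <-> gdiff a b = gdiff c d.
Proof. by split=> [H|/eqmodP/asboolP//]; apply/eqmodP/asboolP. Qed.

Lemma gdiffW (P : groth -> Prop) : (forall a b, P (gdiff a b)) -> forall x, P x.
Proof. by move=> PF x; rewrite -[x]reprK; case: (repr x) => a b; exact: PF. Qed.

Lemma gdiff_repr (a b : S) : groth_eq (repr (gdiff a b)) (a, b).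
Proof.
by case E : (repr _) => [c d]; apply/gdiffP; rewrite /gdiff -E reprK.
Qed.

Definition grothD (x y : groth) : groth :=
  gdiff ((repr x).1 + (repr y).1) ((repr x).2 + (repr y).2).
Definition grothN (x : groth) : groth := gdiff (repr x).2 (repr x).1.
Definition grothM (x y : groth) : groth :=
  gdiff ((repr x).1 * (repr y).1 + (repr x).2 * (repr y).2)
        ((repr x).1 * (repr y).2 + (repr x).2 * (repr y).1).

Lemma grothDE a b c d : grothD (gdiff a b) (gdiff c d) = gdiff (a + c) (b + d).
Proof.
apply/gdiffP; have [e /= E] := gdiff_repr a b; have [f /= E'] := gdiff_repr c d.
move: (repr _) (repr _) E E' => [y1 y2] [x1 x2] /= E E'.
exists (e + f) => /=.
have -> :
  x1 + y1 + (b + d) + (e + f) = (x1 + b + e) + (y1 + d + f) by ring.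
by rewrite E E'; ring.
Qed.

Lemma grothNE a b : grothN (gdiff a b) = gdiff b a.
Proof.
apply/gdiffP; have [e /= E] := gdiff_repr a b; exists e => /=.
by rewrite addrC [_ + a]addrC addrC -E [_ + b]addrC.
Qed.

Lemma grothME a b c d :
  grothM (gdiff a b) (gdiff c d) = gdiff (a * c + b * d) (a * d + b * c).
Proof.
have hl x1 x2 y1 y2 e : x1 + b + e = a + x2 + e ->
    gdiff (x1 * y1 + x2 * y2) (x1 * y2 + x2 * y1) =
    gdiff (a * y1 + b * y2) (a * y2 + b * y1).
  move=> E; apply/gdiffP; exists (e * y1 + e * y2) => /=.
  have -> : x1 * y1 + x2 * y2 + (a * y2 + b * y1) + (e * y1 + e * y2) =
    (x1 + b + e) * y1 + (a + x2 + e) * y2 by ring.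
  transitivity ((a + x2 + e) * y1 + (x1 + b + e) * y2); last by ring.
  by rewrite E.
have hr y1 y2 f : y1 + d + f = c + y2 + f ->
    gdiff (a * y1 + b * y2) (a * y2 + b * y1) =
    gdiff (a * c + b * d) (a * d + b * c).
  move=> E; apply/gdiffP; exists (f * a + f * b) => /=.
  have -> : a * y1 + b * y2 + (a * d + b * c) + (f * a + f * b) =
    (y1 + d + f) * a + (c + y2 + f) * b by ring.
  transitivity ((c + y2 + f) * a + (y1 + d + f) * b); last by ring.
  by rewrite E.
have [e /= E] := gdiff_repr a b; have [f /= E'] := gdiff_repr c d.
by rewrite /grothM (hl _ _ _ _ _ E) (hr _ _ _ E').
Qed.

Lemma grothDA : associative grothD.
Proof.
elim/gdiffW=> a b; elim/gdiffW=> c d; elim/gdiffW=> e f.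
by rewrite !grothDE !addrA.
Qed.
Lemma grothDC : commutative grothD.
Proof.
elim/gdiffW=> a b; elim/gdiffW=> c d.
by rewrite !grothDE addrC [b + d]addrC.
Qed.
Lemma groth0D : left_id (gdiff 0 0) grothD.
Proof. by elim/gdiffW=> a b; rewrite grothDE !add0r. Qed.
Lemma grothND : left_inverse (gdiff 0 0) grothN grothD.
Proof.
elim/gdiffW=> a b; rewrite grothNE grothDE.
by apply/gdiffP; exists 0; rewrite /= !addr0 add0r addrC.
Qed.
Lemma grothMA : associative grothM.
Proof.
elim/gdiffW=> a b; elim/gdiffW=> c d; elim/gdiffW=> e f.
by rewrite !grothME; congr gdiff; ring.
Qed.
Lemma grothMC : commutative grothM.
Proof.
elim/gdiffW=> a b; elim/gdiffW=> c d.
by rewrite !grothME; congr gdiff; ring.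
Qed.
Lemma groth1M : left_id (gdiff 1 0) grothM.
Proof.
by elim/gdiffW=> a b; rewrite grothME; congr gdiff; ring.
Qed.
Lemma grothMDl : left_distributive grothM grothD.
Proof.
elim/gdiffW=> a b; elim/gdiffW=> c d; elim/gdiffW=> e f.
by rewrite [grothD (gdiff a b) _]grothDE !grothME grothDE; congr gdiff; ring.
Qed.

HB.instance Definition _ := GRing.isZmodule.Build groth
  grothDA grothDC groth0D grothND.
HB.instance Definition _ := GRing.Zmodule_isComPzRing.Build groth
  grothMA grothMC groth1M grothMDl.
End Grothendieck.

Section GrothendieckWitt.
Variable K : fieldType.

Definition GW := groth (isoclass K).
HB.instance Definition _ := GRing.ComPzRing.on GW.

Lemma GW_oner_neq0 : 1 != 0 :> GW.
Proof.
apply/eqP => /gdiffP[e]; rewrite /= !add0r addr0.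
elim/isoclW: e => F; rewrite [LHS]isoclassDE => /isoclassP/isom_mx_dim /= /eqP.
by rewrite eqn_leq ltnn.
Qed.

HB.instance Definition _ := GRing.PzSemiRing_isNonZero.Build GW GW_oner_neq0.

Definition gw_of_form (F : form K) : GW := gdiff (isocl F) 0.

(* The class <c> of the form (x, y) |-> c x y on K. For c = 0 this form is
   degenerate and insubd falls back to the zero-dimensional form. *)
Definition gw_diag (c : K) : GW :=
  gw_of_form (insubd (form0 K) (Tagged (fun n => 'M[K]_n) (c%:M : 'M_1))).

Lemma gw_diag1 : gw_diag 1 = 1.
Proof.
rewrite /gw_diag; congr (gw_of_form _); apply/val_inj.
by rewrite /insubd insubT //= /is_form /= trmx1 eqxx unitmx1.
Qed.

Definition gw_hyp : GW := gw_diag 1 + gw_diag (-1).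

Definition edge_mult (w : nat) : GW :=
  if odd w then gw_hyp *+ (w.-1)./2 + gw_diag w%:R else gw_hyp *+ w./2.
End GrothendieckWitt.

Section FloorDiagrams.
Variable d : nat.

(* The vertices 1, ..., d are the elements 0, ..., d - 1 of 'I_d. *)
Definition edge : Type := ('I_d * 'I_d * nat)%type.
HB.instance Definition _ := Choice.on edge.
Definition src (e : edge) : 'I_d := e.1.1.
Definition tgt (e : edge) : 'I_d := e.1.2.
Definition wt (e : edge) : nat := e.2.

Definition divergence (s : seq edge) (v : 'I_d) : int :=
  (\sum_(e <- s | tgt e == v) wt e)%N%:Z - (\sum_(e <- s | src e == v) wt e)%N%:Z.

Definition is_floor (s : seq edge) : bool :=
  all (fun e => (src e < tgt e)%N && (0 < wt e)%N) s
  && [forall v, divergence s v <= 1].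

(* The edge set is the set of positions in the sequence, so that multiple edges,
   also of equal weight, are allowed. *)
Record floor_diagram := FloorDiagram { edges :> seq edge; _ : is_floor edges }.
HB.instance Definition _ := [isSub for edges].
HB.instance Definition _ := [Choice of floor_diagram by <:].

(* perm_eq says that there is a bijection between the edges preserving end
   points and weights, see fd_isoP. *)
Definition fd_iso (D D' : floor_diagram) : bool := perm_eq D D'.

Lemma fd_isoP (D D' : floor_diagram) :
  fd_iso D D' <-> exists2 f : 'I_(size D) -> 'I_(size D'), bijective f &
    forall i, tnth (in_tuple D') (f i) = tnth (in_tuple D) i.
Proof.
split=> [pDD|[f [g fK gK] fE]].
  have sz : size D == size D' by rewrite (perm_size pDD).
  have szV : size D' == size D by rewrite eq_sym.
  have /tuple_permP[p Dp] : perm_eq (in_tuple D) (Tuple szV) by [].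
  exists (fun i => cast_ord (eqP sz) (p i)).
    apply: inj_card_bij; last by rewrite !card_ord (eqP szV).
    by move=> i j /cast_ord_inj/perm_inj.
  move=> i; have /(congr1 (fun s => nth (tnth (in_tuple D) i) s i)) := Dp.
  rewrite /= -[LHS](tnth_nth _ (in_tuple D)).
  rewrite -[X in nth _ (codom X)]/(tnth _ \o p) => ->.
  rewrite -(tnth_nth _ [tuple tnth (Tuple szV) (p i) | i < size D]) tnth_mktuple.
  rewrite [RHS](tnth_nth (tnth (in_tuple D) i)).
  by rewrite [LHS](tnth_nth (tnth (in_tuple D) i)).
have DE (X : floor_diagram) :
  edges X = map (tnth (in_tuple X)) (enum 'I_(size X)) by rewrite map_tnth_enum.
rewrite /fd_iso (DE D) (DE D').
rewrite -(eq_map fE) map_comp; apply: perm_map; apply: uniq_perm.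
- by rewrite map_inj_uniq ?enum_uniq //; apply: can_inj fK.
- exact: enum_uniq.
- by move=> i; rewrite mem_enum -[i]gK map_f // mem_enum.
Qed.

Lemma fd_iso_equiv : equiv_class_of fd_iso.
Proof.
split=> [D|D D'|D' D D'']; rewrite /fd_iso.
- exact: perm_refl.
- exact: perm_sym.
- exact: perm_trans.
Qed.
Canonical fd_iso_equiv_rel := EquivRelPack fd_iso_equiv.

Definition floor_class := {eq_quot fd_iso_equiv_rel}.
HB.instance Definition _ := EqQuotient.on floor_class.
HB.instance Definition _ := Choice.on floor_class.

Definition genus (D : floor_diagram) : int := 1 - d%:Z + (size D)%:Z.
Definition cogenus (D : floor_diagram) : int :=
  (((d%:Z - 1) * (d%:Z - 2)) %/ 2)%Z - genus D.

Section Markings.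
Variable D : floor_diagram.

(* White vertices, black vertices subdividing the edges, and the d additional
   black vertices. *)
Definition mvertex : Type := ('I_d + ('I_(size D) + 'I_d))%type.
HB.instance Definition _ := Finite.on mvertex.

Definition white (v : 'I_d) : mvertex := inl v.

(* Weight of the edge from x to y in the marked graph, 0 if there is none; att k
   is the white vertex to which the k-th additional black vertex is attached.
   The marked graph has no multiple edges, as D has no loops. *)
Definition mweight (att : {ffun 'I_d -> 'I_d}) (x y : mvertex) : nat :=
  match x, y with
  | inl u, inr (inl i) =>
      let e := tnth (in_tuple D) i in if src e == u then wt e else 0
  | inr (inl i), inl v =>
      let e := tnth (in_tuple D) i in if tgt e == v then wt e else 0
  | inr (inr k), inl v => if att k == v then 1 else 0
  | _, _ => 0
  end%N.

(* The attaching map and the (graph of the) total order. *)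
Definition premarking : Type := ({ffun 'I_d -> 'I_d} * {set mvertex * mvertex})%type.
HB.instance Definition _ := Finite.on premarking.

(* mle M x y: x is at most y in the order of the marking M. *)
Definition mle (M : premarking) : rel mvertex := fun x y => (x, y) \in M.2.

Record is_marking (M : premarking) : Prop := IsMarking {
  marking_div : forall v : 'I_d,
    (\sum_x mweight M.1 x (white v))%N%:Z - (\sum_x mweight M.1 (white v) x)%N%:Z = 1;
  marking_total : total (mle M);
  marking_antisym : antisymmetric (mle M);
  marking_trans : transitive (mle M);
  marking_white : forall u v : 'I_d, mle M (white u) (white v) = (u <= v)%N;
  marking_edge : forall x y, (0 < mweight M.1 x y)%N -> mle M x y
}.

Definition marking_equiv (M M' : premarking) : bool :=
  [exists f : {perm mvertex},
    [&& [forall v, f (white v) == white v],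
        [forall x, forall y, mweight M'.1 (f x) (f y) == mweight M.1 x y] &
        [forall x, forall y, mle M' (f x) (f y) == mle M x y]]].

Lemma marking_equiv_rel : equivalence_rel marking_equiv.
Proof.
have mul (M1 M2 M3 : premarking) :
    marking_equiv M1 M2 -> marking_equiv M2 M3 -> marking_equiv M1 M3.
  move=> /existsP[f /and3P[/forallP fw /forallP fm /forallP fl]].
  move=> /existsP[g /and3P[/forallP gw /forallP gm /forallP gl]].
  apply/existsP; exists (f * g)%g; apply/and3P; split; apply/forallP=> x.
  - by rewrite permM (eqP (fw x)).
  - apply/forallP=> y; rewrite !permM.
    by rewrite (eqP (forallP (gm (f x)) (f y))) (eqP (forallP (fm x) y)).
  - apply/forallP=> y; rewrite !permM.
    by rewrite (eqP (forallP (gl (f x)) (f y))) (eqP (forallP (fl x) y)).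
have inv (M1 M2 : premarking) : marking_equiv M1 M2 -> marking_equiv M2 M1.
  move=> /existsP[f /and3P[/forallP fw /forallP fm /forallP fl]].
  apply/existsP; exists f^-1%g; apply/and3P; split; apply/forallP=> x.
  - by rewrite -{1}(eqP (fw x)) permK.
  - apply/forallP=> y.
    by rewrite -(eqP (forallP (fm (f^-1%g x)) (f^-1%g y))) !permKV.
  - apply/forallP=> y.
    by rewrite -(eqP (forallP (fl (f^-1%g x)) (f^-1%g y))) !permKV.
move=> M1 M2 M3; split=> [|M12].
  apply/existsP; exists 1%g; apply/and3P.
  by split; apply/forallP=> x; rewrite ?perm1 //; apply/forallP=> y; rewrite !perm1.
by apply/idP/idP => [M13|]; [apply: mul M13; apply: inv | apply: mul].
Qed.

Definition nu : nat :=
  #|equivalence_partition marking_equiv [set M | `[< is_marking M >]]%SET|.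
End Markings.

(* Each edge of D gives two edges of a marking; the additional edges have
   weight 1 and multiplicity <1> = 1. *)
Definition fd_mult (K : fieldType) (D : floor_diagram) : GW K :=
  \prod_(e <- D) edge_mult K (wt e) ^+ 2.

Lemma fd_mult_iso (K : fieldType) (D D' : floor_diagram) :
  fd_iso D D' -> fd_mult K D = fd_mult K D'.
Proof. by move=> DD'; apply: perm_big. Qed.

Lemma nu_iso (D D' : floor_diagram) : fd_iso D D' -> nu D = nu D'.
Proof.
move=> /fd_isoP[f [g fK gK] fE].
pose h (x : mvertex D) : mvertex D' :=
  match x with inl v => inl v | inr (inl i) => inr (inl (f i)) | inr (inr k) => inr (inr k) end.
pose h' (x : mvertex D') : mvertex D :=
  match x with inl v => inl v | inr (inl i) => inr (inl (g i)) | inr (inr k) => inr (inr k) end.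
have hK : cancel h h' by move=> [v|[i|k]] //=; rewrite fK.
have h'K : cancel h' h by move=> [v|[i|k]] //=; rewrite gK.
have hm att x y : mweight att (h x) (h y) = mweight att x y.
  by case: x y => [u|[i|k]] [v|[j|l]] //=; rewrite fE.
have h'm att x y : mweight att (h' x) (h' y) = mweight att x y.
  by rewrite -hm !h'K.
pose H (M : premarking D) : premarking D' :=
  (M.1, [set p | (h' p.1, h' p.2) \in M.2]%SET).
pose H' (M : premarking D') : premarking D :=
  (M.1, [set p | (h p.1, h p.2) \in M.2]%SET).
have HK : cancel H H'.
  by move=> [a L]; congr (_, _); apply/setP => -[x y]; rewrite !inE /= !hK.
have H'K : cancel H' H.
  by move=> [a L]; congr (_, _); apply/setP => -[x y]; rewrite !inE /= !h'K.
have mleH M x y : mle (H M) x y = mle M (h' x) (h' y) by rewrite /mle inE.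
have mleH' M x y : mle (H' M) x y = mle M (h x) (h y) by rewrite /mle inE.
have Hmk M : is_marking M -> is_marking (H M).
  case=> mdiv mtot manti mtr mw me; split.
  - move=> v; rewrite -(mdiv v); congr (Posz _ - Posz _);
    (rewrite (reindex h); last by (exists h' => ? _; rewrite ?hK ?h'K)).
      by apply: eq_bigr => x _; exact: (hm _ x (white D v)).
    by apply: eq_bigr => x _; exact: (hm _ (white D v) x).
  - by move=> x y; rewrite !mleH; apply: mtot.
  - move=> x y; rewrite !mleH => /manti; exact: can_inj h'K _ _.
  - by move=> y x z; rewrite !mleH; apply: mtr.
  - by move=> u v; rewrite mleH -mw.
  - by move=> x y; rewrite mleH -h'm => /me.
have H'mk M : is_marking M -> is_marking (H' M).
  case=> mdiv mtot manti mtr mw me; split.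
  - move=> v; rewrite -(mdiv v); congr (Posz _ - Posz _);
    (rewrite (reindex h'); last by (exists h => ? _; rewrite ?hK ?h'K)).
      by apply: eq_bigr => x _; exact: (h'm _ x (white D' v)).
    by apply: eq_bigr => x _; exact: (h'm _ (white D' v) x).
  - by move=> x y; rewrite !mleH'; apply: mtot.
  - move=> x y; rewrite !mleH' => /manti; exact: can_inj hK _ _.
  - by move=> y x z; rewrite !mleH'; apply: mtr.
  - by move=> u v; rewrite mleH' -mw.
  - by move=> x y; rewrite mleH' -hm => /me.
have Heq M N : marking_equiv (H M) (H N) = marking_equiv M N.
  apply/existsP/existsP => -[p /and3P[/forallP pw /forallP pm /forallP pl]].
    have qI : injective (h' \o p \o h).
      by apply: inj_comp (can_inj hK); apply: inj_comp (can_inj h'K) (@perm_inj _ _).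
    exists (perm qI); apply/and3P; split; apply/forallP=> x; rewrite ?permE /=.
    - by rewrite (eqP (pw x)).
    - apply/forallP=> y; rewrite !permE /= h'm.
      by rewrite (eqP (forallP (pm (h x)) (h y))) hm.
    - apply/forallP=> y; rewrite !permE /=.
      by rewrite -mleH (eqP (forallP (pl (h x)) (h y))) mleH !hK.
  have qI : injective (h \o p \o h').
    by apply: inj_comp (can_inj h'K); apply: inj_comp (can_inj hK) (@perm_inj _ _).
  exists (perm qI); apply/and3P; split; apply/forallP=> x; rewrite ?permE /=.
  - by rewrite (eqP (pw x)).
  - apply/forallP=> y; rewrite !permE /= hm.
    by rewrite (eqP (forallP (pm (h' x)) (h' y))) h'm.
  - apply/forallP=> y; rewrite !permE /= mleH !hK.
    by rewrite (eqP (forallP (pl (h' x)) (h' y))) mleH.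
rewrite /nu -(card_imset _ (imset_inj (can_inj HK))); congr (#|pred_of_set _|).
have HA (M : premarking D) : `[< is_marking (H M) >] = `[< is_marking M >].
  by apply/asboolP/asboolP => [/H'mk|/Hmk//]; rewrite HK.
apply/setP=> B; apply/imsetP/imsetP.
- move=> [_ /imsetP[M] Mm -> ->]; rewrite finset.in_set in Mm.
  exists (H M); first by rewrite finset.in_set HA.
  apply/setP=> N; rewrite -[N]H'K (mem_imset _ _ (can_inj HK)) !finset.in_set.
  by rewrite Heq HA.
- move=> [M + ->]; rewrite finset.in_set -[M]H'K HA => Mm.
  exists [set N in [set N | `[< is_marking N >]] | marking_equiv (H' M) N]%SET.
    by apply/imsetP; exists (H' M); rewrite ?finset.in_set.
  apply/setP=> N; rewrite -[N]H'K (mem_imset _ _ (can_inj HK)) !finset.in_set.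
  by rewrite Heq HA.
Qed.

End FloorDiagrams.

Lemma floor_weight_le (d : nat) (D : floor_diagram d) (e : edge d) :
  e \in edges D -> (wt e <= d)%N.
Proof.
move=> eD; have /andP[/allP Dw /forallP Ddiv] := valP D.
pose above (v : 'I_d) := (src e < v)%N.
have div1 v : (\sum_(f <- D | tgt f == v) wt f <=
               \sum_(f <- D | src f == v) wt f + 1)%N.
  by have := Ddiv v; rewrite /divergence lerBlDl.
have : (\sum_(v | above v) \sum_(f <- D | tgt f == v) wt f <=
        \sum_(v | above v) (\sum_(f <- D | src f == v) wt f + 1))%N.
  by apply: leq_sum => v _; apply: div1.
rewrite big_split /= sum1_card.
have part (p : edge d -> 'I_d) :
    (\sum_(v | above v) \sum_(f <- D | p f == v) wt f =
     \sum_(f <- D | above (p f)) wt f)%N.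
  rewrite [RHS](partition_big p above) //=; apply: eq_bigr => v av.
  apply: eq_bigl => f; case: eqP => [->|]; rewrite ?av ?andbF //.
rewrite !part (bigID (fun f => above (src f))) /=.
have -> : (\sum_(f <- D | above (tgt f) && above (src f)) wt f =
           \sum_(f <- D | above (src f)) wt f)%N.
  rewrite [LHS]big_seq_cond [RHS]big_seq_cond; apply: eq_bigl => f.
  case fD : (f \in _) => //=; have /andP[fst _] := Dw f fD.
  case af : (above (src f)); rewrite ?andbF //.
  by have -> : above (tgt f) by exact: ltn_trans af fst.
rewrite leq_add2l (big_rem e) //=.
have -> : above (tgt e) by have /andP[] := Dw e eD.
have -> : above (src e) = false by apply: ltnn.
rewrite /=.
move=> /(leq_trans (leq_addr _ _))/leq_trans; apply.
by rewrite -[X in (_ <= X)%N]card_ord max_card.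
Qed.

Lemma finite_floor_class (d : nat) (delta : int) :
  finite_set [set D : floor_class d | cogenus (repr D) = delta]%classic.
Proof.
pose T := ('I_d * 'I_d * 'I_d.+1)%type.
pose n := absz ((((d%:Z - 1) * (d%:Z - 2)) %/ 2)%Z - delta - 1 + d%:Z).
pose down (t : T) : edge d := (t.1, val t.2).
have D0P : is_floor ([::] : seq (edge d)).
  by apply/andP; split=> //; apply/forallP=> v; rewrite /divergence !big_nil.
pose D0 := FloorDiagram D0P.
pose h (t : n.-tuple T) : floor_class d :=
  \pi_(floor_class d)%qT (insubd D0 (map down t) : floor_diagram d).
apply: (@sub_finite_set _ _ (h @` setT)%classic); last first.
  exact/finite_image/finite_finset.
move=> D /= Dg; have sz : size (repr D) = n.
  by rewrite /n -Dg /cogenus /genus; lia.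
pose up (e : edge d) : T := (e.1, inord (wt e)).
have szm : size (map up (repr D)) == n by rewrite size_map sz.
exists (Tuple szm) => //; rewrite /h /= -map_comp map_id_in => [|e eD].
  rewrite -[edges _]/(val (repr D)) valKd; exact: reprK.
rewrite /= /down /up /= inordK ?ltnS; last exact: floor_weight_le eD.
by case: e {eD}.
Qed.

(* The sum over isomorphism classes is finite by finite_floor_class, and its terms
   do not depend on the representatives by fd_mult_iso and nu_iso. *)
Definition floor_count (K : fieldType) (delta d : nat) : GW K :=
  \sum_(D \in [set D : floor_class d | cogenus (repr D) = delta%:Z]%classic)
    fd_mult K (repr D) * (nu (repr D))%:R.

(* Main.v *)
Require Import Defs.
From mathcomp Require Import all_boot all_order all_algebra.
From mathcomp Require Import perm mxtens.
From mathcomp Require Import ring lra zify.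
From mathcomp Require finmap boolp classical_sets cardinality fsbigop.

Set Implicit Arguments.
Unset Strict Implicit.
Unset Printing Implicit Defensive.

Import Order.TTheory GRing.Theory Num.Theory.
Local Open Scope ring_scope.

(** An edge of weight [w] contributes [((w^2 - o) / 2) H + o <1>], [o] being the
    parity of [w], so the count is determined by two integer counts, with edge
    weights [w^2] and [o].

    Add a source vertex 0 from which the [d] additional ends start. Listing the
    black vertices in the order of the marking identifies the marked floor
    diagrams of degree [d] with words in the edges such that the edges across the
    gap between vertices [i] and [i + 1] have total weight [d - i]; the cogenus is
    the sum of [length * weight - 1] over the edges. All but at most [delta] edges
    are therefore short (length and weight 1). Cutting a word at the first vertex
    which no edge passes gives the recursion
    [F y c = \sum_(l, c') T l y c' * F (y - l) (c - c')], where [T l y c'] counts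
    indecomposable words. Such a word is a bounded arrangement of long edges into
    which short ones are shuffled, so [T l y c] is a sum of products of binomial
    coefficients, eventually a polynomial in [y] of degree at most [c], and
    [T 1 y 0 = 1]. Hence [F (y + 1) c - F y c] has degree [2c - 1], and [F y c] has
    degree [2c] with leading coefficient [t^c / (2^c c!)], where [t] is the leading
    coefficient of [\sum_l T l y 1]. This [t] is larger for the weights [w^2] than
    for the parities, which gives the degree of the coefficient of [H]. *)

(** * Eventually polynomial functions *)

(** The coefficient [a] in degree [n] may vanish: what is recorded is a degree bound with the
    coefficient at that bound, so that terms of lower degree can join a sum with coefficient 0. *)
Definition eventually_poly (n : nat) (a : rat) (g : nat -> rat) : Prop :=
  exists p : {poly rat}, [/\ (size p <= n.+1)%N, p`_n = a &
    exists y0, forall y, (y0 <= y)%N -> g y = p.[y%:R]].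

Lemma eventually_poly_ext n a g h y0 :
  (forall y, (y0 <= y)%N -> h y = g y) ->
  eventually_poly n a g -> eventually_poly n a h.
Proof.
move=> gh [p [sp pn [y1 gp]]]; exists p; split=> //; exists (maxn y0 y1) => y.
by rewrite geq_max => /andP[y0y y1y]; rewrite gh ?gp.
Qed.

Lemma eventually_poly_const a : eventually_poly 0 a (fun _ => a).
Proof.
exists a%:P; split; rewrite ?size_polyC_leq1 ?coefC //.
by exists 0%N => y _; rewrite hornerC.
Qed.

Lemma eventually_poly_zero n : eventually_poly n 0 (fun _ => 0).
Proof. by exists 0; split; rewrite ?size_poly0 ?coef0 //; exists 0%N => y _;
  rewrite horner0. Qed.

Lemma eventually_poly_weaken n m a g : (n < m)%N ->
  eventually_poly n a g -> eventually_poly m 0 g.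
Proof.
move=> nm [p [sp _ gp]]; exists p; split=> //; first by rewrite (leq_trans sp) // ltnW.
by rewrite nth_default // (leq_trans sp).
Qed.

Lemma eventually_poly_add n a b g h : eventually_poly n a g ->
  eventually_poly n b h -> eventually_poly n (a + b) (fun y => g y + h y).
Proof.
move=> [p [sp pn [y0 gp]]] [q [sq qn [y1 hq]]]; exists (p + q); split.
- by rewrite (leq_trans (size_polyD _ _)) // geq_max sp.
- by rewrite coefD pn qn.
- exists (maxn y0 y1) => y; rewrite geq_max => /andP[y0y y1y].
  by rewrite hornerD gp ?hq.
Qed.

Lemma eventually_poly_sum n (I : eqType) (r : seq I) (a : I -> rat) (g : I -> nat -> rat) :
  (forall i, i \in r -> eventually_poly n (a i) (g i)) ->
  eventually_poly n (\sum_(i <- r) a i) (fun y => \sum_(i <- r) g i y).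
Proof.
elim: r => [|i r IHr] ag.
  rewrite big_nil; apply: (@eventually_poly_ext _ _ (fun _ => 0) _ 0) => [y _|].
    by rewrite big_nil.
  exact: eventually_poly_zero.
rewrite big_cons; apply: (@eventually_poly_ext _ _ _ _ 0) => [y _|].
  by rewrite big_cons.
apply: eventually_poly_add; first by apply: ag; rewrite mem_head.
by apply: IHr => j jr; apply: ag; rewrite inE jr orbT.
Qed.

Lemma coef_mul_top (p q : {poly rat}) n m : (size p <= n.+1)%N ->
  (size q <= m.+1)%N -> (p * q)`_(n + m) = p`_n * q`_m.
Proof.
move=> sp sq; rewrite coefM.
rewrite (bigD1 (inord n)) //= big1 ?addr0 => [|[i ilt] /eqP iN /=].
  by rewrite inordK ?ltnS ?leq_addr // addKn.
have : i != n.
  by apply/eqP => E; apply: iN; apply/val_inj; rewrite /= inordK ?E // ltnS leq_addr.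
rewrite neq_ltn => /orP[] lt.
  by rewrite (@nth_default _ _ q) ?mulr0 //; lia.
by rewrite (@nth_default _ _ p) ?mul0r //; lia.
Qed.

Lemma eventually_poly_mul n m a b g h : eventually_poly n a g ->
  eventually_poly m b h -> eventually_poly (n + m) (a * b) (fun y => g y * h y).
Proof.
move=> [p [sp pn [y0 gp]]] [q [sq qn [y1 hq]]]; exists (p * q); split.
- by rewrite (leq_trans (size_polyMleq _ _)) //; lia.
- by rewrite coef_mul_top ?pn ?qn.
- exists (maxn y0 y1) => y; rewrite geq_max => /andP[y0y y1y].
  by rewrite hornerM gp ?hq.
Qed.

Lemma eventually_poly_prod (I : eqType) (r : seq I) (n : I -> nat) (a : I -> rat)
    (g : I -> nat -> rat) :
  (forall i, i \in r -> eventually_poly (n i) (a i) (g i)) ->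
  eventually_poly (\sum_(i <- r) n i) (\prod_(i <- r) a i) (fun y => \prod_(i <- r) g i y).
Proof.
elim: r => [|i r IHr] ag.
  rewrite !big_nil; apply: (@eventually_poly_ext _ _ (fun _ => 1) _ 0) => [y _|].
    by rewrite big_nil.
  exact: eventually_poly_const.
rewrite !big_cons; apply: (@eventually_poly_ext _ _ _ _ 0) => [y _|].
  by rewrite big_cons.
apply: eventually_poly_mul; first by apply: ag; rewrite mem_head.
by apply: IHr => j jr; apply: ag; rewrite inE jr orbT.
Qed.

Lemma size_comp_XaddC (p : {poly rat}) (c : rat) : size (p \Po ('X + c%:P)) = size p.
Proof. by rewrite size_comp_poly2 // size_XaddC. Qed.

Lemma coef_comp_XaddC_top (p : {poly rat}) c n : (size p <= n.+1)%N ->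
  (p \Po ('X + c%:P))`_n = p`_n.
Proof.
rewrite leq_eqVlt => /orP[/eqP sp|sp]; last first.
  by rewrite !nth_default ?size_comp_XaddC.
have := lead_coef_comp p (q := 'X + c%:P).
rewrite size_XaddC => /(_ isT); rewrite /lead_coef size_comp_XaddC sp /= => ->.
by rewrite size_XaddC /= coefD coefX coefC /= addr0 expr1n mulr1.
Qed.

Lemma eventually_poly_shift n a g l : eventually_poly n a g ->
  eventually_poly n a (fun y => g (y - l)%N).
Proof.
move=> [p [sp pn [y0 gp]]]; exists (p \Po ('X + (- l%:R)%:P)); split.
- by rewrite size_comp_XaddC.
- by rewrite coef_comp_XaddC_top.
(* From [l] on the truncated difference [y - l] is the true one. *)
- exists (y0 + l)%N => y yl; rewrite gp; last by lia.
  by rewrite horner_comp !hornerE natrB //; lia.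
Qed.

Lemma eventually_poly_succ n a g : eventually_poly n a g ->
  eventually_poly n a (fun y => g y.+1).
Proof.
move=> [p [sp pn [y0 gp]]]; exists (p \Po ('X + 1%:P)); split.
- by rewrite size_comp_XaddC.
- by rewrite coef_comp_XaddC_top.
- exists y0 => y yy; rewrite gp ?(leq_trans yy) // horner_comp !hornerE.
  by rewrite mulrSr.
Qed.

(** Discrete integration by induction on the size: the forward difference of
    [p_n / (n + 1) X^(n + 1)] has degree at most [n] and agrees with [p] in degree [n], so
    subtracting it from [p] leaves a smaller polynomial. The factor [*+ (0 < n)] makes the
    coefficient condition trivial for [n = 0]. *)
Lemma poly_antidifference n (p : {poly rat}) : (size p <= n)%N ->
  exists q : {poly rat}, [/\ (size q <= n.+1)%N, q`_n *+ n = p`_n.-1 *+ (0 < n) &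
    q \Po ('X + 1%:P) - q = p].
Proof.
elim: n p => [|n IHn] p sp.
  exists 0; rewrite size_poly0 mulr0n; split=> //.
  by rewrite comp_poly0 subr0; apply/esym/eqP; rewrite -size_poly_leq0.
pose q0 : {poly rat} := (p`_n / n.+1%:R) *: 'X^(n.+1).
have sq0 : (size q0 <= n.+2)%N.
  by rewrite (leq_trans (size_scale_leq _ _)) // size_polyXn.
pose d0 := q0 \Po ('X + 1%:P) - q0.
have cd0 : d0`_n = p`_n.
  rewrite /d0 coefB /q0 comp_polyZ !coefZ coefXn ltn_eqF // mulr0 subr0.
  (* Only the binomial term of index 1, [(n + 1) X^n], has degree [n]. *)
  rewrite comp_Xn_poly exprDn coef_sum (bigD1 (Ordinal (isT : (1 < n.+2)%N))) //=.
    rewrite big1 => [|i iN]; last first.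
      rewrite polyC1 expr1n mulr1 coefMn coefXn.
      case: eqP => [ni|]; last by rewrite mul0rn.
      case/eqP: iN; apply/val_inj => /=; have := ltn_ord i; lia.
    rewrite subSS subn0 polyC1 expr1n mulr1 coefMn coefXn eqxx bin1 addr0 -[1 *+ _]/(_%:R).
    by rewrite divfK // pnatr_eq0.
have sd0 : (size (p - d0)%R <= n)%N.
  apply/leq_sizeP => j; rewrite leq_eqVlt => /orP[/eqP <-|nj].
    by rewrite coefB cd0 subrr.
  rewrite coefB [p`_j]nth_default ?(leq_trans sp) // sub0r /d0 coefB.
  move: nj; rewrite leq_eqVlt => /orP[/eqP <-|nj].
    by rewrite coef_comp_XaddC_top ?subrr ?oppr0.
  by rewrite !nth_default ?size_comp_XaddC ?subrr ?oppr0 // (leq_trans sq0).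
have [q [sq _ dq]] := IHn _ sd0.
exists (q0 + q); split.
- by rewrite (leq_trans (size_polyD _ _)) // geq_max sq0 (leq_trans sq).
- rewrite coefD (@nth_default _ _ q) // addr0 coefZ coefXn eqxx mulr1 /= mulr1n.
  by rewrite -[LHS]mulr_natr divfK ?mulr1n // pnatr_eq0.
- rewrite comp_polyD opprD addrACA dq; rewrite -/d0; ring.
Qed.

Lemma eventually_poly_antidifference n a g :
  eventually_poly n a (fun y => g y.+1 - g y) ->
  eventually_poly n.+1 (a / n.+1%:R) g.
Proof.
move=> [p [sp pn [y0 gp]]]; have [q [sq cq dq]] := poly_antidifference sp.
(* From [y0] on, [g] is determined by its differences up to a constant, which the value at [y0]
   fixes. *)
pose k := g y0 - q.[y0%:R].
exists (q + k%:P); split.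
- by rewrite (leq_trans (size_polyD _ _)) // geq_max sq (leq_trans (size_polyC_leq1 _)).
- rewrite coefD coefC addr0; move: cq; rewrite /= mulr1n pn => <-.
  by rewrite -(mulr_natr q`_n.+1) mulfK // pnatr_eq0.
- exists y0 => y /subnK <-; elim: (y - y0)%N => [|m IHm].
    by rewrite add0n hornerD hornerC /k; ring.
  have := gp (m + y0)%N (leq_addl _ _); rewrite -dq => /eqP.
  rewrite subr_eq => /eqP; rewrite addSn => ->; rewrite IHm.
  rewrite !hornerE /= horner_comp !hornerE [in RHS]mulrSr /=; ring.
Qed.

(** By Pascal's rule the forward difference of ['C(y + m + 1, m + 1)] is ['C(y + 1 + m, m)], so the
    induction on [m] is a summation. *)
Lemma eventually_poly_bin m k :
  eventually_poly m (m`!%:R^-1) (fun y => ('C(y - k + m, m))%:R).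
Proof.
apply: (@eventually_poly_shift m (m`!%:R^-1) (fun y => ('C(y + m, m))%:R) k).
elim: m => [|m IHm].
  apply: (@eventually_poly_ext _ _ (fun _ => 1) _ 0) => [y _|]; first by rewrite bin0.
  by rewrite fact0 invr1; apply: eventually_poly_const.
rewrite factS natrM invfM mulrC; apply: eventually_poly_antidifference.
apply: (@eventually_poly_ext _ _ (fun y => (fun y' => ('C(y' + m, m))%:R) (y.+1)) _ 0).
  by move=> y _; rewrite addSn binS natrD addnS [X in X - _]addrC; rewrite addSn addrK.
exact: (eventually_poly_succ IHm).
Qed.

(** * Decomposition of words *)

(* In gap [g], between the vertices [g] and [g + 1], the letter [(a, b, w)] marks
   an edge of weight [w] from vertex [g - a] to vertex [g + b + 1]; vertex 0 is the
   source of the additional ends. *)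
Notation letter := (nat * nat * nat)%type.
Definition lback (e : letter) : nat := e.1.1.
Definition lfore (e : letter) : nat := e.1.2.
Definition lwt (e : letter) : nat := e.2.
Definition lcost (e : letter) : nat := ((lback e + lfore e).+1 * lwt e).-1.

(** One word for each gap: the black vertices between two consecutive vertices, in the order of the
    marking. *)
Notation gap_words := (seq (seq letter)).

Fixpoint place (n : nat) (u : gap_words) : seq (nat * letter) :=
  if u is x :: u' then map (pair n) x ++ place n.+1 u' else [::].

(** The edge marked by [z] stays between the vertices 0 and [n], the range of [n] gaps. *)
Definition fits (n : nat) (z : nat * letter) : bool :=
  [&& lback z.2 <= z.1, z.1 + lfore z.2 < n & 0 < lwt z.2]%N.

Definition covers (i : nat) (z : nat * letter) : bool :=
  (z.1 <= i + lback z.2)%N && (i <= z.1 + lfore z.2)%N.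

Definition closed (u : gap_words) : bool := all (fits (size u)) (place 0 u).

Definition load (u : gap_words) (i : nat) : nat :=
  \sum_(z <- place 0 u | covers i z) lwt z.2.

Definition cost (u : gap_words) : nat := \sum_(z <- place 0 u) lcost z.2.

Lemma place_cat n u v : place n (u ++ v) = place n u ++ place (n + size u) v.
Proof. by elim: u n => [|x u IHu] n /=; rewrite ?addn0 // IHu catA addSnnS. Qed.

Lemma place_shift n m u :
  place (n + m) u = map (fun z => (z.1 + m, z.2)%N) (place n u).
Proof.
elim: u n => [|x u IHu] n //=; rewrite map_cat -addSn IHu; congr (_ ++ _).
by rewrite -map_comp.
Qed.

Lemma mem_place n u z : (z \in place n u) =
  [&& n <= z.1, z.1 < n + size u & z.2 \in nth [::] u (z.1 - n)]%N.
Proof.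
elim: u n => [|x u IHu] n /=; first by rewrite nth_nil !andbF.
rewrite mem_cat IHu {IHu}; case: z => g e /=.
have -> : ((g, e) \in map (pair n) x) = (g == n) && (e \in x).
  apply/mapP/andP => [[e' ex [-> ->]]|[/eqP -> ex]]; first by rewrite eqxx.
  by exists e.
case: (ltngtP g n) => [//|ng|->] /=.
  by rewrite addnS addSn -[(g - n)%N]prednK ?subn_gt0 // -subnS.
by rewrite orbF subnn addnS ltnS leq_addr.
Qed.

Lemma filter_place n u g :
  [seq z <- place n u | z.1 == g] =
  if (n <= g < n + size u)%N then map (pair g) (nth [::] u (g - n)) else [::].
Proof.
elim: u n => [|x u IHu] n /=; first by rewrite addn0 ltnNge andbN.
rewrite filter_cat IHu filter_map.
have -> : [seq e <- x | preim (pair n) (fun z => z.1 == g) e] = if n == g then x else [::].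
  by rewrite (eq_filter (a2 := fun=> n == g)) //; case: (n == g);
    rewrite ?filter_predT ?filter_pred0.
case: (ltngtP n g) => [ng|//|->] /=.
  by rewrite addnS addSn -[(g - n)%N]prednK ?subn_gt0 // -subnS.
by rewrite subnn /= addnS ltnS leq_addr cats0.
Qed.

Lemma fits_shift n m z : fits n z -> fits (n + m) (z.1 + m, z.2)%N.
Proof. by case: z => g e; rewrite /fits /=; lia. Qed.

Lemma fits_leq n m z : (n <= m)%N -> fits n z -> fits m z.
Proof. by case: z => g e; rewrite /fits /=; lia. Qed.

Lemma closed_cat u v : closed u -> closed v -> closed (u ++ v).
Proof.
move=> /allP cu /allP cv; rewrite /closed place_cat all_cat size_cat.
apply/andP; split; apply/allP => z.
  by move=> /cu; apply: fits_leq; apply: leq_addr.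
by rewrite place_shift => /mapP[z' /cv /fits_shift + ->]; rewrite addnC; apply.
Qed.


(** In closed words an edge of [u] covers only gaps before [size u], and an edge of [v] only gaps
    from there on. *)
Lemma load_cat u v i : closed u -> closed v ->
  load (u ++ v) i = if (i < size u)%N then load u i else load v (i - size u).
Proof.
move=> /allP cu /allP cv.
rewrite /load place_cat big_cat place_shift big_map /=.
have [iu|ui] := ltnP i (size u).
  rewrite [X in (_ + X)%N]big_seq_cond [X in (_ + X)%N]big_pred0 ?addn0 // => z.
  by apply/negP => /andP[/cv + ]; rewrite /fits /covers /=; lia.
rewrite [X in (X + _)%N]big_seq_cond [X in (X + _)%N]big_pred0 ?add0n // => [|z].
  by apply: eq_bigl => z; rewrite /covers /=; lia.
by apply/negP => /andP[/cu + ]; rewrite /fits /covers /=; lia.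
Qed.

Lemma cost_cat u v : cost (u ++ v) = (cost u + cost v)%N.
Proof. by rewrite /cost place_cat big_cat place_shift big_map. Qed.

(** * Finite enumeration of words *)

Section Enumeration.
Variable T : choiceType.
Implicit Types (A : seq T) (s : seq T).

Fixpoint seqs_upto A (n : nat) : seq (seq T) :=
  if n is m.+1 then [::] :: [seq x :: s | x <- A, s <- seqs_upto A m] else [:: [::]].

Lemma mem_seqs_upto A n s :
  (s \in seqs_upto A n) = (size s <= n)%N && all (mem A) s.
Proof.
elim: n s => [|n IHn] [|x s] //=; rewrite inE /= ltnS.
apply/allpairsP/and3P => [[[y t] /= [yA tA [-> ->]]]|[ss xA sA]].
  by move: tA; rewrite IHn => /andP[-> ->].
by exists (x, s); split=> //=; rewrite IHn ss.
Qed.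
End Enumeration.

Definition letters_upto (n : nat) : seq letter :=
  [seq (p, w) | p <- [seq (a, b) | a <- iota 0 n.+1, b <- iota 0 n.+1], w <- iota 0 n.+1].

Lemma mem_letters_upto n e :
  [&& lback e <= n, lfore e <= n & lwt e <= n]%N -> e \in letters_upto n.
Proof.
case: e => [[a b] w] /and3P[an bn wn].
by rewrite allpairs_f ?allpairs_f ?mem_iota.
Qed.

(* [u] can be the first [l] gaps of a word of degree [y]. *)
Definition loaded (l y : nat) (u : gap_words) : bool :=
  [&& size u == l, closed u & all (fun i => load u i == y - i)%N (iota 0 l)].

Lemma lwt_le_load u z i : z \in place 0 u -> covers i z -> (lwt z.2 <= load u i)%N.
Proof. by move=> zu zi; rewrite /load (big_rem z) //= zi leq_addr. Qed.

Lemma covers_self g e : covers g (g, e).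
Proof. by rewrite /covers /= !leq_addr. Qed.

Lemma place0_nth u g : [seq z <- place 0 u | z.1 == g] = map (pair g) (nth [::] u g).
Proof.
rewrite filter_place add0n subn0 /=; case: ltnP => // ug.
by rewrite nth_default.
Qed.

Lemma gap_size_le_load u g : closed u -> (size (nth [::] u g) <= load u g)%N.
Proof.
move=> /allP cu; rewrite -(size_map (pair g)) -place0_nth size_filter -sum1_count.
rewrite /load big_mkcond [X in (_ <= X)%N]big_mkcond /= big_seq [X in (_ <= X)%N]big_seq.
apply: leq_sum => -[h e] /cu /and3P[_ _ w0] /=; case: eqP => // ->.
by rewrite covers_self.
Qed.

(* Opaque, so that conversion does not start enumerating words. *)
Lemma families_subproof l y :
  {s : seq gap_words | uniq s & forall u, (u \in s) = loaded l y u}.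
Proof.
(* A letter reaches fewer than [l] gaps back or forth and weighs at most the load [y - i] of its gap
   [i]; this load also bounds the number of letters in the gap. *)
exists [seq u <- undup (seqs_upto (seqs_upto (letters_upto (l + y)) y) l) | loaded l y u].
  by rewrite filter_uniq // undup_uniq.
move=> u; rewrite mem_filter andb_idr // => /and3P[/eqP su cu /allP lu].
have luE i : (i < l)%N -> load u i = (y - i)%N.
  by move=> il; apply/eqP/lu; rewrite mem_iota.
rewrite mem_undup mem_seqs_upto su leqnn /=.
apply/allP => x /(nthP [::])[g + <-]; rewrite su => gl.
rewrite inE mem_seqs_upto (leq_trans (gap_size_le_load _ cu)) ?luE ?leq_subr //=.
apply/allP => e eg; have zu : (g, e) \in place 0 u.
  by rewrite mem_place /= add0n su gl subn0.
have := lwt_le_load zu (covers_self g e); rewrite luE //= => wy; apply: mem_letters_upto.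
by have := allP cu _ zu; rewrite /fits /= su; move: wy; lia.
Qed.

Definition families (l y : nat) : seq gap_words := s2val (families_subproof l y).

Lemma families_uniq l y : uniq (families l y).
Proof. exact: (s2valP (families_subproof l y)). Qed.

Lemma mem_families l y u : (u \in families l y) = loaded l y u.
Proof. exact: (s2valP' (families_subproof l y)). Qed.

(** For closed [u] this says that no edge passes vertex [i]: both parts are words in their own
    right. *)
Definition cut (u : gap_words) (i : nat) : bool := closed (take i u) && closed (drop i u).

(** The first cut vertex after vertex 0. For a nonempty closed word the search succeeds, because the
    end [size u] is a cut. *)
Definition split_index (u : gap_words) : nat := (find (cut u) (iota 1 (size u))).+1.

Definition prim (u : gap_words) : bool :=
  [&& closed u, (0 < size u)%N & split_index u == size u].

Lemma split_index_eq u l : (0 < l <= size u)%N -> cut u l ->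
  (forall j, (0 < j < l)%N -> ~~ cut u j) -> split_index u = l.
Proof.
move=> /andP[l0 lu] cl cN; rewrite /split_index -[RHS](prednK l0); congr _.+1.
have -> : iota 1 (size u) = iota 1 l.-1 ++ l :: iota l.+1 (size u - l).
  have {1}-> : size u = (l.-1 + (size u - l).+1)%N by lia.
  by rewrite iotaD add1n prednK.
rewrite find_cat /= cl; case: ifP => [/hasP[j]|_]; last by rewrite size_iota addn0.
by rewrite mem_iota => jl /negP[]; apply/negP/cN; lia.
Qed.

Lemma split_indexP u : closed u -> (0 < size u)%N ->
  [/\ (0 < split_index u <= size u)%N, cut u (split_index u) &
      forall j, (0 < j < split_index u)%N -> ~~ cut u j].
Proof.
move=> cu u0; have hu : has (cut u) (iota 1 (size u)).
  apply/hasP; exists (size u); rewrite ?mem_iota ?add1n ?u0 ?ltnS //=.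
  by rewrite /cut take_size drop_size cu.
have fl : (find (cut u) (iota 1 (size u)) < size u)%N by rewrite -[X in
  (_ < X)%N](size_iota 1) -has_find.
split=> //.
  by have := nth_find 0%N hu; rewrite nth_iota // add1n.
move=> j /andP[j0]; rewrite /split_index ltnS => jf.
have jl : (j.-1 < find (cut u) (iota 1 (size u)))%N by lia.
have /negbT := before_find 0%N jl; rewrite nth_iota ?add1n ?prednK //; lia.
Qed.

Lemma cut_cat_prefix u v i : (i <= size u)%N -> closed v -> cut u i -> cut (u ++ v) i.
Proof.
move=> iu cv /andP[ct cd]; rewrite /cut takel_cat // ct /=.
by rewrite drop_cat; case: ltngtP iu cd => // [iu _ cd|->];
  [exact: closed_cat | rewrite subnn drop0].
Qed.

(** In [drop i u ++ v] a letter of [u] only has to end before the end of [v]; that it ends within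
    [u] comes from [u] being closed. *)
Lemma cut_catP u v i : (i < size u)%N -> closed u -> cut (u ++ v) i -> cut u i.
Proof.
move=> iu /allP cu /andP[]; rewrite takel_cat 1?ltnW // => ct.
rewrite drop_cat iu => /allP cd; rewrite /cut ct /=; apply/allP => z zd.
have : z \in place 0 (drop i u ++ v) by rewrite place_cat mem_cat zd.
move=> /cd; have : (z.1 + i, z.2)%N \in place 0 u.
  rewrite -[u in place 0 u](cat_take_drop i) place_cat mem_cat add0n.
  rewrite size_takel 1?ltnW // -[X in place X (drop _ _)]add0n place_shift.
  by apply/orP; right; exact: (map_f (fun z : nat * letter => (z.1 + i, z.2)%N) zd).
by move=> /cu; case: z {zd} => g [[a b] w]; rewrite /fits /lback /lfore /lwt /= size_drop; lia.
Qed.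

(** An earlier cut of the prefix would already be a cut of [u], by [cut_cat_prefix]. *)
Lemma prim_take_split u : closed u -> (0 < size u)%N ->
  prim (take (split_index u) u) /\ closed (drop (split_index u) u).
Proof.
move=> cu u0; have [/andP[i0 iu] ci cN] := split_indexP cu u0.
have /andP[ct cd] := ci; split=> //.
have st : size (take (split_index u) u) = split_index u by rewrite size_takel.
rewrite /prim ct st i0 /=; apply/eqP/split_index_eq; rewrite ?st ?i0 ?leqnn //.
  by rewrite /cut -[X in take X (take _ _)]st take_size -[X in
    drop X (take _ _)]st drop_size ct.
move=> j jl; apply: contra (cN j jl) => cj.
rewrite -[X in cut X](cat_take_drop (split_index u)); apply: cut_cat_prefix => //.
by rewrite st; lia.
Qed.

(** A cut before the end of [u] would be a cut of [u] itself, by [cut_catP]. With [prim_take_split]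
    this makes the decomposition unique. *)
Lemma split_index_cat u v : prim u -> closed v -> split_index (u ++ v) = size u.
Proof.
move=> /and3P[cu u0 /eqP su] cv; have [_ _ cN] := split_indexP cu u0.
apply: split_index_eq; rewrite ?size_cat ?u0 ?leq_addr //.
  by rewrite /cut take_size_cat // drop_size_cat // cu.
move=> j jl; apply: contra (cN j _); last by rewrite su.
by apply: cut_catP => //; case/andP: jl.
Qed.

(** * Weighted counts and their recursion *)

Section Counting.
Variable f : nat -> rat.

Definition weight (u : gap_words) : rat := \prod_(z <- place 0 u) f (lwt z.2).

Lemma weight_cat u v : weight (u ++ v) = weight u * weight v.
Proof. by rewrite /weight place_cat big_cat place_shift big_map. Qed.

Definition count_if (P : pred gap_words) (d c : nat) : rat :=
  \sum_(u <- families d d | P u && (cost u == c)) weight u.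

Definition count_all (d c : nat) : rat := count_if predT d c.

Definition count_prim (P : pred gap_words) (l y c : nat) : rat :=
  \sum_(u <- families l y | [&& prim u, P u & cost u == c]) weight u.

Lemma sum_indicator (c n : nat) (a : rat) :
  \sum_(i <- iota 0 c.+1) (if n == i then a else 0) = if (n <= c)%N then a else 0.
Proof.
case: leqP => nc.
  rewrite (bigD1_seq n) ?mem_iota ?iota_uniq //= eqxx big1 ?addr0 // => i.
  by rewrite eq_sym => /negPf ->.
rewrite big_seq big1 // => i; rewrite mem_iota add0n => ic.
by rewrite gtn_eqF // (leq_ltn_trans _ nc).
Qed.

(** A Cauchy product: under concatenation cost is additive and weight multiplicative, and the cost
    of the first factor singles out one [c']. *)
Lemma sum_convolution (r s : seq gap_words) (P : pred gap_words) c :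
  \sum_(c' <- iota 0 c.+1)
     (\sum_(u <- r | P u && (cost u == c')) weight u) *
     (\sum_(v <- s | cost v == (c - c')%N) weight v) =
  \sum_(u <- r | P u) \sum_(v <- s | (cost u + cost v == c)%N) weight (u ++ v).
Proof.
transitivity (\sum_(c' <- iota 0 c.+1) \sum_(u <- r | P u) (if cost u == c' then
    weight u * \sum_(v <- s | cost v == (c - cost u)%N) weight v else 0)).
  apply: eq_bigr => c' _; rewrite big_distrl big_mkcondr /=.
  by apply: eq_bigr => u _; case: eqP => // ->.
rewrite exchange_big /=; apply: eq_bigr => u _.
rewrite sum_indicator; case: leqP => uc.
  rewrite big_distrr /=; apply: eq_big => [v|v _]; last by rewrite weight_cat.
  by rewrite -[in RHS](subnKC uc) eqn_add2l.
rewrite big_pred0 // => v; apply/eqP; move: uc; lia.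
Qed.

(** After [l] gaps the required load has dropped to [y - l], so what follows is a complete word of
    degree [y - l]. *)
Lemma loaded_cat l y u v : (l <= y)%N -> loaded l y u ->
  loaded (y - l) (y - l) v -> loaded y y (u ++ v).
Proof.
move=> ly /and3P[/eqP su cu /allP lu] /and3P[/eqP sv cv /allP lv].
rewrite /loaded size_cat su sv subnKC // eqxx closed_cat //=.
apply/allP => i; rewrite mem_iota add0n /= => iy; rewrite load_cat // su.
case: ltnP => li; first by rewrite lu // mem_iota.
have /eqP -> : load v (i - l) == (y - l - (i - l))%N by rewrite lv // mem_iota; lia.
by apply/eqP; lia.
Qed.

Lemma loaded_split y i u : cut u i -> (i <= y)%N -> loaded y y u ->
  loaded i y (take i u) /\ loaded (y - i) (y - i) (drop i u).
Proof.
move=> /andP[ct cd] iy /and3P[/eqP su cu /allP lu].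
have st : size (take i u) = i by rewrite size_takel // su.
have lE j : (j < y)%N -> load u j = (y - j)%N.
  by move=> jy; apply/eqP/lu; rewrite mem_iota.
rewrite /loaded size_drop su st !eqxx ct cd /=; split; apply/allP => j;
  rewrite mem_iota add0n /= => ji.
  apply/eqP; rewrite -lE ?(leq_trans ji) // -[in RHS](cat_take_drop i u) load_cat //.
  by rewrite st ji.
have ijy : (i + j < y)%N by lia.
have := lE _ ijy; rewrite -{1}(cat_take_drop i u) load_cat // st ltnNge leq_addr /=.
by rewrite addKn => ->; apply/eqP; lia.
Qed.

(** [P] is decided by the first primitive factor. This will hold for the condition on the edges at
    the source, none of which starts after a cut. *)
Definition prefix_closed (P : pred gap_words) : Prop :=
  forall u v, prim u -> closed v -> P (u ++ v) = P u.

(** Cutting at the first cut vertex is a bijection from words to pairs of a primitive word and a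
    remaining word. As [P] only concerns the former, the latter is counted by [count_all]. *)
Lemma count_if_split P y c : prefix_closed P ->
  count_if P y.+1 c = \sum_(l <- iota 1 y.+1) \sum_(c' <- iota 0 c.+1)
    count_prim P l y.+1 c' * count_all (y.+1 - l) (c - c').
Proof.
move=> Pcat; set Y := y.+1.
pose pairs l := [seq (u, v) | u <- [seq u <- families l Y | prim u && P u],
                             v <- families (Y - l) (Y - l)].
have pairs_perm l : (0 < l <= Y)%N ->
    perm_eq [seq p.1 ++ p.2 | p <- pairs l]
            [seq u <- families Y Y | P u && (split_index u == l)].
  move=> /andP[l0 lY]; apply: uniq_perm.
  (* Concatenation is injective here because the first component always has [l] gaps. *)
  - rewrite map_inj_in_uniq; last first.
      move=> [u v] [u' v'] /allpairsPdep[x [x' [+ _ [-> ->]]]] /allpairsPdep[z [z' [+ _ [->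
        ->]]]].
      rewrite mem_filter mem_families mem_filter mem_families =>
        /andP[_ /and3P[/eqP sx _ _]] /andP[_ /and3P[/eqP sz _ _]] /= /eqP.
      by rewrite eqseq_cat ?sx ?sz // => /andP[/eqP -> /eqP ->].
    by apply: allpairs_uniq; rewrite ?filter_uniq ?families_uniq // => -[? ?] [? ?].
  - by rewrite filter_uniq ?families_uniq.
  - move=> u; rewrite mem_filter mem_families; apply/mapP/idP.
      move=> [p /allpairsPdep[x [z [+ + ->]]] ->] /=.
      rewrite mem_filter mem_families mem_families => /andP[/andP[px Px] lx] lz.
      have [/eqP sx _ _] := and3P lx; have [_ cz _] := and3P lz.
      by rewrite Pcat // Px split_index_cat // sx eqxx /=; apply: loaded_cat lx lz.
    move=> /andP[/andP[Pu /eqP su] lu]; have [/eqP Yu cu _] := and3P lu.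
    have u0 : (0 < size u)%N by rewrite Yu.
    have [pt cd] := prim_take_split cu u0; rewrite su in pt cd.
    have [_ ctu _] := split_indexP cu u0; rewrite su in ctu.
    have [lt ld] := loaded_split ctu lY lu.
    exists (take l u, drop l u); last by rewrite /= cat_take_drop.
    apply: allpairs_f; rewrite ?mem_filter mem_families // lt pt -(Pcat _ (drop l u)) //.
    by rewrite cat_take_drop Pu.
(* The words are sorted by their first cut, which lies between 1 and [Y]. *)
have -> : count_if P Y c = \sum_(l <- iota 1 Y)
    \sum_(u <- [seq u <- families Y Y | P u && (split_index u == l)] | cost u == c) weight u.
  transitivity (\sum_(u <- families Y Y | P u && (cost u == c))
      \sum_(l <- iota 1 Y) (if split_index u == l then weight u else 0)).
    rewrite /count_if big_seq_cond [RHS]big_seq_cond; apply: eq_bigr => u /andP[+ _].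
    rewrite mem_families => /and3P[/eqP Yu cu _].
    have u0 : (0 < size u)%N by rewrite Yu.
    have [lsu _ _] := split_indexP cu u0.
    rewrite (bigD1_seq (split_index u)) ?iota_uniq ?mem_iota -/Y -?Yu ?add1n //=.
    by rewrite eqxx big1 ?addr0 // => l; rewrite eq_sym => /negPf ->.
  rewrite exchange_big /=; apply: eq_bigr => l _.
  by rewrite -big_mkcondr big_filter_cond; apply: eq_bigl => u; rewrite andbAC.
rewrite big_seq [RHS]big_seq; apply: eq_bigr => l; rewrite mem_iota => lP.
rewrite -(perm_big _ (pairs_perm l _)); last by lia.
rewrite big_map /=.
have -> : \sum_(c' <- iota 0 c.+1) count_prim P l Y c' * count_all (Y - l) (c - c') =
  \sum_(c' <- iota 0 c.+1) (\sum_(u <- families l Y | (prim u && P u) && (cost u == c'))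
    weight u) *
     (\sum_(v <- families (Y - l) (Y - l) | cost v == (c - c')%N) weight v).
  by apply: eq_bigr => c' _; congr (_ * _); apply: eq_bigl => u; rewrite andbA.
rewrite sum_convolution big_mkcond big_allpairs_dep big_filter /=.
by apply: eq_bigr => u _; rewrite [RHS]big_mkcond; apply: eq_bigr => v _; rewrite cost_cat.
Qed.
End Counting.

(** * Polynomiality *)

(** The condition on [z] says that its edge starts before vertex [i] and ends after it. If no edge
    does, each letter fits the part of [u] in which it lies. *)
Lemma uncut_crossed u i : closed u -> ~~ cut u i ->
  exists2 z, z \in place 0 u & ((z.1 < i + lback z.2) && (i <= z.1 + lfore z.2))%N.
Proof.
move=> cu; have [il|li] := leqP i (size u); last first.
  by rewrite /cut take_oversize ?drop_oversize ?cu // ltnW.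
case: (boolP (has (fun z => (z.1 < i + lback z.2) && (i <= z.1 + lfore z.2))%N (place 0 u))).
  by case/hasP=> z; exists z.
move=> /hasPn nz /negP[]; rewrite -{1}(cat_take_drop i u) place_cat size_takel // in nz cu *.
have zu z : z \in place 0 u -> fits (size u) z by apply: (allP cu).
rewrite -{1}(cat_take_drop i u) place_cat size_takel // add0n in zu nz.
apply/andP; split; apply/allP => z zP.
  have zT : z \in place 0 (take i u) ++ place i (drop i u) by rewrite mem_cat zP.
  have := nz z zT; have := zu z zT; move: zP; rewrite mem_place size_takel //.
  case: z {zT} => g [[a b] w]; rewrite /fits /lback /lfore /lwt /=; lia.
have zT : (z.1 + i, z.2)%N \in place 0 (take i u) ++ place i (drop i u).
  rewrite mem_cat -[X in place X (drop _ _)]add0n place_shift; apply/orP; right.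
  exact: (map_f (fun z : nat * letter => (z.1 + i, z.2)%N) zP).
have := nz _ zT; have := zu _ zT; rewrite size_drop.
case: z {zT zP} => g [[a b] w]; rewrite /fits /lback /lfore /lwt /=; lia.
Qed.

Lemma count_interval lo hi m n :
  (count (fun i => (lo < i + m) && (i <= hi))%N (iota 1 n) <= hi + m - lo)%N.
Proof.
rewrite -size_filter -[X in (_ <= X)%N](size_iota (lo.+1 - m)).
apply: uniq_leq_size; first by rewrite filter_uniq ?iota_uniq.
by move=> i; rewrite mem_filter !mem_iota; lia.
Qed.

(** Each of the [size u - 1] inner vertices is passed by some edge, while an edge of length [a] and
    weight [w] passes at most [a - 1 <= a w - 1] vertices, the latter being its cost. *)
Lemma prim_size_le u : prim u -> (size u <= (cost u).+1)%N.
Proof.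
case/and3P=> cu u0 /eqP su; have [_ _ cN] := split_indexP cu u0.
rewrite su in cN; rewrite -(prednK u0) ltnS.
pose crosses i (z : nat * letter) := ((z.1 < i + lback z.2) && (i <= z.1 + lfore z.2))%N.
rewrite -[X in (X <= _)%N](size_iota 1) -sum1_size.
apply: (@leq_trans (\sum_(i <- iota 1 (size u).-1) \sum_(z <- place 0 u) crosses i z)).
  rewrite big_seq [X in (_ <= X)%N]big_seq; apply: leq_sum => i; rewrite mem_iota => iP.
  have /(uncut_crossed cu)[z zu zi] : ~~ cut u i by apply: cN; lia.
  by rewrite (big_rem z) //= /crosses zi.
rewrite exchange_big /= /cost big_seq [X in (_ <= X)%N]big_seq; apply: leq_sum => z zu.
rewrite -big_mkcond /= sum1_count.
have := count_interval z.1 (z.1 + lfore z.2) (lback z.2) (size u).-1.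
have := allP cu _ zu; case: z {zu} => g [[a b] w].
rewrite /fits /crosses /lcost /lback /lfore /lwt /=; nia.
Qed.

(** * Skeletons and the insertion of short edges *)

Definition short : letter := (0, 0, 1)%N.
(** Short letters cost nothing and pass no vertex, so closedness, cuts, primitivity and cost depend
    only on the long letters that remain. *)
Definition skel (u : gap_words) : gap_words := map (filter (predC1 short)) u.

Lemma size_skel u : size (skel u) = size u. Proof. exact: size_map. Qed.

Lemma place_skel n u : place n (skel u) = [seq z <- place n u | z.2 != short].
Proof.
elim: u n => [|x u IHu] n //=; rewrite filter_cat IHu; congr (_ ++ _).
by rewrite filter_map.
Qed.

Lemma closed_skel u : closed (skel u) = closed u.
Proof.
rewrite /closed size_skel place_skel all_filter; apply: eq_in_all => z.
rewrite mem_place add0n /= => /andP[zu _]; case: eqP => [E|//] /=.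
by rewrite /fits E /lback /lfore /lwt /= addn0 zu.
Qed.

Lemma cut_skel u i : cut (skel u) i = cut u i.
Proof. by rewrite /cut /skel -map_take -map_drop !closed_skel. Qed.

Lemma prim_skel u : prim (skel u) = prim u.
Proof.
by rewrite /prim closed_skel size_skel /split_index (eq_find (cut_skel u)) size_skel.
Qed.

Lemma cost_skel u : cost (skel u) = cost u.
Proof.
rewrite /cost place_skel big_filter big_mkcond; apply: eq_bigr => z _.
by case: eqP => //= ->.
Qed.

Lemma skel_idem u : skel (skel u) = skel u.
Proof. by rewrite /skel -map_comp; apply: eq_map => x /=; rewrite filter_id. Qed.

Lemma load_skel u i : load u i = (load (skel u) i + count_mem short (nth [::] u i))%N.
Proof.
rewrite /load place_skel big_filter_cond (bigID (fun z => z.2 == short)) /= addnC.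
congr (_ + _)%N; first by apply: eq_bigl => z; rewrite andbC.
have -> : count_mem short (nth [::] u i) =
    count (fun z => z.2 == short) [seq z <- place 0 u | z.1 == i].
  by rewrite place0_nth count_map; apply: eq_count => e.
rewrite count_filter -sum1_count; apply: eq_big => [z|z /andP[_ /eqP -> //]].
rewrite andbC -[RHS]/((z.2 == short) && (z.1 == i)); case: eqP => [E|//] /=.
by rewrite /covers E /lback /lfore /= !addn0 -eqn_leq.
Qed.

(** All ways to insert [h] short letters into [v]. The recursion is on [v] and, for fixed [v], on
    [h], according to whether the word begins with a short letter or with the head of [v]. *)
Fixpoint shuffles (v : seq letter) : nat -> seq (seq letter) :=
  if v is x :: v' then
    fix aux h := if h is h'.+1 then map (cons short) (aux h') ++ map (cons x) (shuffles v' h)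
                 else [:: v]
  else fun h => [:: nseq h short].

Lemma shufflesS x v h : shuffles (x :: v) h.+1 =
  map (cons short) (shuffles (x :: v) h) ++ map (cons x) (shuffles v h.+1).
Proof. by []. Qed.

Lemma size_shuffles v h : size (shuffles v h) = 'C(h + size v, size v).
Proof.
elim: v h => [|x v IHv] h; first by rewrite bin0.
elim: h => [|h IHh]; first by rewrite add0n binn.
by rewrite shufflesS size_cat !size_map IHh IHv /= [in RHS]addSn binS addSnnS.
Qed.

Lemma mem_shuffles v h x : all (predC1 short) v ->
  (x \in shuffles v h) = (filter (predC1 short) x == v) && (count_mem short x == h).
Proof.
elim: v h x => [|y v IHv] h x.
  move=> _ /=; rewrite inE; apply/eqP/andP => [->|[/eqP x0 /eqP <-]].
    by rewrite filter_nseq count_nseq /= ?eqxx /= ?mul0n ?mul1n ?eqxx.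
  elim: x x0 => [|e x IHx] //=; case: (eqVneq e short) => //= -> /IHx xE.
  by rewrite add0n -xE.
move=> /andP[ys0 vs]; have ys : y != short := ys0; elim: h x => [|h IHh] x.
  rewrite inE; apply/eqP/andP => [->|[/eqP <- x0]].
    rewrite /= ys (negPf ys) add0n; split.
      by apply/eqP; congr (_ :: _); apply/all_filterP.
    by rewrite eqn0Ngt -has_count -all_predC.
  by apply/esym/all_filterP; rewrite all_predC has_count -eqn0Ngt.
rewrite shufflesS mem_cat; apply/orP/idP.
  case=> /mapP[t + ->].
    by rewrite IHh => /andP[fx /eqP cx]; rewrite /= cx fx ?add1n ?eqxx.
  by rewrite IHv //= ys (negPf ys) eqseq_cons eqxx.
case: x => [|e x] //=; case: (eqVneq e short) => [->|es] /=.
  by rewrite add1n eqSS -IHh => tx; left; apply: map_f.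
rewrite eqseq_cons add0n -andbA => /and3P[/eqP -> fx cx]; right; apply: map_f.
by rewrite IHv // fx.
Qed.

Lemma shuffles_uniq v h : all (predC1 short) v -> uniq (shuffles v h).
Proof.
elim: v h => [|y v IHv] h // /andP[ys0 vs]; have ys : y != short := ys0;
  elim: h => [|h IHh] //.
rewrite shufflesS cat_uniq !map_inj_uniq ?IHh ?IHv //= => [|? ? []//|? ? []//].
rewrite andbT; apply/hasPn => _ /mapP[t _ ->]; apply/mapP => -[t' _ [E]].
by rewrite E eqxx in ys.
Qed.

Fixpoint fillings (p : seq (nat * seq letter)) : seq gap_words :=
  if p is q :: p' then [seq x :: u | x <- shuffles q.2 q.1, u <- fillings p'] else [:: [::]].

Lemma size_fillings p :
  size (fillings p) = \prod_(q <- p) 'C(q.1 + size q.2, size q.2).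
Proof.
elim: p => [|q p IHp]; first by rewrite big_nil.
by rewrite big_cons /= size_allpairs size_shuffles IHp.
Qed.

Lemma mem_fillings p u : all (fun q => all (predC1 short) q.2) p ->
  (u \in fillings p) = all2 (fun x q => (filter (predC1 short) x == q.2) &&
                                      (count_mem short x == q.1)) u p.
Proof.
elim: p u => [|q p IHp] [|x u] //= /andP[qs ps].
  by apply/negP => /allpairsP[[y w] /= [_ _]].
rewrite -mem_shuffles // -IHp //;
  apply/allpairsP/andP => [[[y w] /= [yq wp [-> ->]]]|[xq up]] //.
by exists (x, u).
Qed.

Lemma fillings_uniq p : all (fun q => all (predC1 short) q.2) p -> uniq (fillings p).
Proof.
elim: p => [|q p IHp] //= /andP[qs ps].
by apply: allpairs_uniq; rewrite ?shuffles_uniq ?IHp // => -[? ?] [? ?] _ _ /= [-> ->].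
Qed.

Lemma all2_map_iota (T S : Type) (x0 : T) (Q : T -> S -> bool) (F : nat -> S) n l u :
  all2 Q u (map F (iota n l)) =
  (size u == l) && all (fun i => Q (nth x0 u i) (F (n + i)%N)) (iota 0 l).
Proof.
elim: l n u => [|l IHl] n [|x u] //=.
rewrite IHl addn0 eqSS andbCA; congr (_ && (_ && _)).
rewrite (iotaDl 1 0) all_map; apply: eq_all => i /=.
by rewrite addSnnS.
Qed.

Lemma all_nonshort v : skel v = v -> all (all (predC1 short)) v.
Proof.
by move=> <-; rewrite all_map; apply/allP => x _; apply: filter_all.
Qed.

Lemma lcost_gt0 e : (0 < lwt e)%N -> e != short -> (0 < lcost e)%N.
Proof.
case: e => [[a b] w]; rewrite /lcost /lback /lfore /lwt /=.
case: w => [|[|w]] // _.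
by case: a => [|a]; [case: b => [|b] //|]; rewrite /= muln1.
Qed.

Lemma sum_sizes (v : gap_words) n : (\sum_(x <- v) size x = size (place n v))%N.
Proof.
elim: v n => [|x v IHv] n; first by rewrite big_nil.
by rewrite big_cons (IHv n.+1) /= size_cat size_map.
Qed.

(** Every letter that is not short costs at least 1. Equality means that all of them cost exactly 1;
    such skeletons give the top degree below. *)
Lemma skeleton_size v : closed v -> skel v = v ->
  (\sum_(x <- v) size x <= cost v)%N.
Proof.
move=> /allP cv sv; rewrite (sum_sizes _ 0) /cost -sum1_size.
rewrite big_seq [X in (_ <= X)%N]big_seq; apply: leq_sum => z zv.
apply: lcost_gt0; first by case/and3P: (cv _ zv).
by move: zv; rewrite -sv place_skel mem_filter => /andP[].
Qed.

Lemma skeletons_subproof l c : {s : seq gap_words | uniq s & forall v,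
  (v \in s) = [&& size v == l, closed v, cost v == c & skel v == v]}.
Proof.
(* Total cost [c] allows at most [c] long letters, each of length and weight at most [c + 1]. *)
exists [seq v <- undup (seqs_upto (seqs_upto (letters_upto c.+1) c) l) |
     [&& size v == l, closed v, cost v == c & skel v == v]].
  by rewrite filter_uniq // undup_uniq.
move=> v; rewrite mem_filter andb_idr // => /and4P[/eqP sv cv /eqP co /eqP kv].
rewrite mem_undup mem_seqs_upto sv leqnn /=; apply/allP => x xv.
have sx : (size x <= c)%N.
  apply: leq_trans (_ : \sum_(x <- v) size x <= _)%N; last by rewrite -co skeleton_size.
  by rewrite (big_rem x) //= leq_addr.
rewrite inE mem_seqs_upto sx /=; apply/allP => e ex; rewrite inE.
apply: mem_letters_upto.
have zu : (index x v, e) \in place 0 v.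
  by rewrite mem_place /= add0n index_mem xv subn0 nth_index.
have w0 : (0 < lwt e)%N by case/and3P: (allP cv _ zu).
have : (lcost e <= c)%N.
  rewrite -co /cost (big_rem _ zu) /=; exact: leq_addr.
move: w0; case: e {ex zu} => [[a b] w]; rewrite /lcost /lback /lfore /lwt /=; nia.
Qed.

Definition skeletons (l c : nat) : seq gap_words := s2val (skeletons_subproof l c).

Lemma skeletons_uniq l c : uniq (skeletons l c).
Proof. exact: (s2valP (skeletons_subproof l c)). Qed.

Lemma mem_skeletons l c v :
  (v \in skeletons l c) = [&& size v == l, closed v, cost v == c & skel v == v].
Proof. exact: (s2valP' (skeletons_subproof l c)). Qed.

(** A short letter adds 1 to the load of its own gap and nothing elsewhere. The required loads thus
    fix the number of short letters in every gap, and the gaps are filled independently. *)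
Lemma fillings_perm l y v : size v = l -> closed v -> skel v = v ->
  (forall i, (i < l)%N -> (load v i <= y - i)%N) ->
  perm_eq [seq u <- families l y | skel u == v]
    (fillings [seq (y - i - load v i, nth [::] v i)%N | i <- iota 0 l]).
Proof.
move=> sv cv kv lv.
have ns : all (fun q => all (predC1 short) q.2)
    [seq (y - i - load v i, nth [::] v i)%N | i <- iota 0 l].
  rewrite all_map; apply/allP => i; rewrite mem_iota /= => il.
  by apply: (allP (all_nonshort kv)); rewrite mem_nth // sv.
apply: uniq_perm; rewrite ?filter_uniq ?families_uniq ?fillings_uniq // => u.
rewrite mem_filter mem_families mem_fillings // (all2_map_iota [::]).
apply/andP/andP => [[/eqP ku /and3P[su cu lu]]|[/eqP su /allP uP]].
  split=> //; apply/allP => i il; rewrite add0n /=.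
  have -> : nth [::] v i = [seq e <- nth [::] u i | predC1 short e].
    by rewrite -ku (nth_map [::]) // (eqP su); move: il; rewrite mem_iota.
  by have := allP lu _ il; rewrite load_skel ku eqxx => /eqP <-; rewrite addKn /=.
have ku : skel u = v.
  apply: (@eq_from_nth _ [::]); rewrite size_skel ?su // => i il.
  have := uP i; rewrite mem_iota add0n /= => /(_ il) /andP[/eqP <- _].
  by rewrite (nth_map [::]) // su.
rewrite ku eqxx /loaded su eqxx -closed_skel ku cv /=; split=> //.
apply/allP => i il; have := uP i il => /andP[_ /eqP]; rewrite add0n (load_skel u) ku => ->.
by rewrite /= subnKC // lv //; move: il; rewrite mem_iota.
Qed.

(** * Words with a given skeleton and primitive words *)

Section Polynomiality.
Variable f : nat -> rat.
Hypothesis f1 : f 1%N = 1.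

Lemma weight_skel u : weight f (skel u) = weight f u.
Proof.
rewrite /weight place_skel big_filter big_mkcond; apply: eq_bigr => z _.
by case: eqP => //= ->.
Qed.

(** A gap with [m] long letters contributes a binomial coefficient with leading coefficient
    [1 / m!]. *)
Definition skel_lead (v : gap_words) : rat := weight f v * \prod_(x <- v) (size x)`!%:R^-1.

Definition skel_count (y : nat) (v : gap_words) : rat :=
  \sum_(u <- families (size v) y | skel u == v) weight f u.

Lemma skel_countE y v : closed v -> skel v = v ->
  (forall i, (i < size v)%N -> (load v i <= y - i)%N) ->
  skel_count y v = weight f v *
    \prod_(i <- iota 0 (size v))
      'C(y - (i + load v i) + size (nth [::] v i), size (nth [::] v i))%:R.
Proof.
move=> cv kv lv; rewrite /skel_count -[LHS]big_filter.
etransitivity; first exact: (perm_big _ (fillings_perm (erefl _) cv kv lv)).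
rewrite big_seq; under eq_bigr => u uP.
  have : u \in [seq u <- families (size v) y | skel u == v].
    by rewrite (perm_mem (fillings_perm (erefl _) cv kv lv)).
  rewrite mem_filter => /andP[/eqP ku _]; rewrite -weight_skel ku; over.
rewrite -big_seq big_const_seq count_predT iter_addr_0 size_fillings big_map /=.
rewrite -mulr_natr natr_prod; congr (_ * _); apply: eq_bigr => i _.
by rewrite subnDA.
Qed.

Lemma skel_count_poly v : closed v -> skel v = v ->
  eventually_poly (\sum_(x <- v) size x) (skel_lead v) (fun y => skel_count y v).
Proof.
move=> cv kv.
(* The sum over all gaps is a crude bound from which on every gap has room for the load of [v]. *)
apply: (@eventually_poly_ext _ _ (fun y => weight f v * \prod_(i <- iota 0 (size v))
      'C(y - (i + load v i) + size (nth [::] v i), size (nth [::] v i))%:R)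
   _ (\sum_(i < size v) (i + load v i))).
  move=> y yP; apply: skel_countE => // i il.
  move: yP; rewrite (bigD1 (Ordinal il)) //=; lia.
rewrite -[X in eventually_poly X]add0n; apply: eventually_poly_mul.
  exact: eventually_poly_const.
have iotaE (R : Type) (idx : R) op (F : seq letter -> R) :
   \big[op/idx]_(x <- v) F x = \big[op/idx]_(i <- iota 0 (size v)) F (nth [::] v i).
  by rewrite -{1}[v](mkseq_nth [::]) /mkseq big_map.
rewrite (iotaE _ _ _ size) (iotaE _ _ _ (fun x => (size x)`!%:R^-1)).
by apply: eventually_poly_prod => i _; apply: eventually_poly_bin.
Qed.

Definition skel_invariant (P : pred gap_words) : Prop := forall u, P (skel u) = P u.

Lemma count_prim_skeletons P l y c : skel_invariant P ->
  count_prim f P l y c = \sum_(v <- skeletons l c | prim v && P v) skel_count y v.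
Proof.
move=> Pinv; rewrite /count_prim -[RHS]big_filter.
set S := [seq v <- skeletons l c | prim v && P v].
transitivity (\sum_(u <- families l y | [&& prim u, P u & cost u == c])
    \sum_(v <- S) (if skel u == v then weight f u else 0)).
  rewrite big_seq_cond [RHS]big_seq_cond; apply: eq_bigr => u.
  rewrite mem_families => /and4P[/and3P[su cu lu] pu Pu cou].
  rewrite (bigD1_seq (skel u)) ?filter_uniq ?skeletons_uniq //=.
    by rewrite eqxx big1 ?addr0 // => v; rewrite eq_sym => /negPf ->.
  by rewrite mem_filter prim_skel Pinv pu Pu mem_skeletons size_skel closed_skel
     cost_skel skel_idem su cu cou eqxx.
rewrite exchange_big big_seq [RHS]big_seq; apply: eq_bigr => v.
rewrite mem_filter mem_skeletons => /andP[/andP[pv Pv] /and4P[/eqP sv cv cov kv]].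
rewrite -big_mkcondr /skel_count sv; apply: eq_bigl => u.
case: (eqVneq (skel u) v) => [uv|_]; last by rewrite andbF.
by rewrite andbT -prim_skel -Pinv -(cost_skel u) uv pv Pv cov.
Qed.

(** The coefficient in degree [c]: a skeleton contributes degree at most its number of letters,
    which is at most its cost [c]. *)
Definition prim_lead (P : pred gap_words) (l c : nat) : rat :=
  \sum_(v <- skeletons l c | prim v && P v)
     (if \sum_(x <- v) size x == c then skel_lead v else 0).

Lemma count_prim_poly P l c : skel_invariant P ->
  eventually_poly c (prim_lead P l c) (fun y => count_prim f P l y c).
Proof.
move=> Pinv; rewrite /prim_lead -big_filter.
apply: (@eventually_poly_ext _ _ (fun y => \sum_(v <- [seq v <- skeletons l c | prim v && P v])
     skel_count y v) _ 0) => [y _|].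
  by rewrite count_prim_skeletons // big_filter.
apply: eventually_poly_sum => v; rewrite mem_filter mem_skeletons.
move=> /andP[_ /and4P[_ cv /eqP cov /eqP kv]].
have := skel_count_poly cv kv; have := skeleton_size cv kv; rewrite cov.
by case: ltngtP => // [lt _ /(eventually_poly_weaken lt)|-> _].
Qed.

Lemma count_prim_oversize P l y c : (c.+1 < l)%N -> count_prim f P l y c = 0.
Proof.
move=> cl; rewrite /count_prim big_seq_cond big_pred0 // => u; apply/negP.
rewrite mem_families => /and4P[/and3P[/eqP su _ _] /prim_size_le pu _ /eqP cu].
by rewrite cu su leqNgt cl in pu.
Qed.

(** The empty skeleton is the only one of cost 0 with a single gap, and it is filled by short
    letters in one way. *)
Lemma count_prim_cost0 P y : skel_invariant P -> P [:: [::]] -> count_prim f P 1 y 0 = 1.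
Proof.
move=> Pinv P0; rewrite count_prim_skeletons //.
have p0 : prim [:: [::]] by [].
rewrite -big_filter (perm_big [:: [:: [::]]]) /=; last first.
  apply: uniq_perm; rewrite ?filter_uniq ?skeletons_uniq // => v.
  rewrite mem_filter mem_skeletons inE; apply/idP/eqP => [|->]; last first.
    by rewrite p0 P0 /cost /= big_nil.
  case/andP=> _ /and4P[/eqP sv cv /eqP cov /eqP kv].
  have := skeleton_size cv kv; rewrite cov leqn0.
  by case: v sv {cv cov kv} => [|[|e x] [|? ?]] //= _; rewrite !big_cons.
rewrite big_seq1 skel_countE //=; last first.
  by move=> [|i] //= _; rewrite /load /= big_nil.
by rewrite /weight /= big_nil mul1r big_seq1 /= bin0.
Qed.

(** For [c' = 0] only [l = 1] survives, with factor 1, and yields [count_all f y c]. Primitive words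
    of cost at most [c] have at most [c + 1] gaps, so the remaining sum has an index set independent
    of [y]; [c <= y] makes room for it. *)
Lemma count_if_rec P c y : prefix_closed P -> skel_invariant P -> P [:: [::]] ->
  (c <= y)%N ->
  count_if f P y.+1 c = count_all f y c +
    \sum_(p <- [seq (l, c') | l <- iota 1 c.+1, c' <- iota 1 c])
       count_prim f P p.1 y.+1 p.2 * count_all f (y.+1 - p.1) (c - p.2).
Proof.
move=> Pcat Pinv P0 cy; rewrite count_if_split //.
have -> : iota 1 y.+1 = iota 1 c.+1 ++ iota c.+2 (y - c).
  by rewrite -(add1n c.+1) -iotaD; congr iota; lia.
set r := [seq (_, _) | _ <- _, _ <- _].
rewrite big_cat /= [X in _ + X]big_seq [X in _ + X]big1 ?addr0 => [|l]; last first.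
  rewrite mem_iota -[0%N :: _]/(iota 0 c.+1) => lP; rewrite big_seq big1 // => c';
    rewrite mem_iota => c'P.
  by rewrite count_prim_oversize ?mul0r //; lia.
rewrite /r big_allpairs_dep.
transitivity (\sum_(l <- iota 1 c.+1) (count_prim f P l y.+1 0 * count_all f (y.+1 - l) c +
   \sum_(c' <- iota 1 c) count_prim f P l y.+1 c' * count_all f (y.+1 - l) (c - c'))).
  by apply: eq_bigr => l _; rewrite big_cons subn0.
rewrite big_split /=; congr (_ + _).
rewrite big_cons count_prim_cost0 // mul1r subSS subn0 big_seq big1 ?addr0 // => l.
by rewrite mem_iota => lP; rewrite count_prim_oversize ?mul0r //; lia.
Qed.
End Polynomiality.

(** By [prim_size_le] a primitive word of cost 1 has one or two gaps. *)
Definition cost1_skeletons : seq gap_words :=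
  [seq v <- skeletons 1 1 ++ skeletons 2 1 | prim v && (\sum_(x <- v) size x == 1)%N].

Definition cost1_lead (f : nat -> rat) : rat := \sum_(v <- cost1_skeletons) skel_lead f v.

(** The solution of [(2c + 2) a_(c+1) = t a_c] with [a_0 = 1], where [t] is [cost1_lead f]. *)
Definition lead_coefficient (f : nat -> rat) (c : nat) : rat :=
  (cost1_lead f / 2) ^+ c / c`!%:R.

(** * Degree and leading coefficient of the counts *)

Section Polynomiality.
Variable f : nat -> rat.
Hypothesis f1 : f 1%N = 1.

Lemma count_all0 : count_all f 0 0 = 1.
Proof.
rewrite /count_all /count_if (perm_big [:: [::]]) /=; last first.
  apply: uniq_perm; rewrite ?families_uniq // => u; rewrite mem_families inE.
  by apply/idP/eqP => [/and3P[/nilP -> //]|->].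
by rewrite big_mkcond big_seq1 /cost /weight !big_nil.
Qed.

Lemma count_all_cost0 y : count_all f y 0 = 1.
Proof.
elim: y => [|y IHy]; first exact: count_all0.
rewrite /count_all count_if_rec // IHy.
by rewrite big_allpairs_dep big1 ?addr0 // => l _; rewrite big_nil.
Qed.

Lemma prim_lead_oversize P l c : (c.+1 < l)%N -> prim_lead f P l c = 0.
Proof.
move=> cl; rewrite /prim_lead big_seq_cond big_pred0 // => v; apply/negP.
rewrite mem_skeletons => /andP[/and4P[/eqP sv _ /eqP cv _] /andP[/prim_size_le pv _]].
by rewrite sv cv leqNgt cl in pv.
Qed.

Lemma cost1_leadE : cost1_lead f = prim_lead f predT 1 1 + prim_lead f predT 2 1.
Proof.
rewrite /cost1_lead /cost1_skeletons filter_cat big_cat.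
by congr (_ + _); rewrite big_filter /prim_lead -big_mkcondr; apply: eq_bigl => v;
  rewrite andbT.
Qed.

Definition correction P (c y : nat) : rat :=
  \sum_(p <- [seq (l, c') | l <- iota 1 c.+1, c' <- iota 1 c])
       count_prim f P p.1 y.+1 p.2 * count_all f (y.+1 - p.1) (c - p.2).

(** The term with cost [c'] has degree at most [c' + 2 (c + 1 - c') = 2c + 2 - c'], so only [c' = 1]
    reaches degree [2c + 1]. *)
Lemma correction_poly P c : skel_invariant P ->
  (forall c', (c' <= c)%N -> eventually_poly (2 * c') (lead_coefficient f c') (fun y =>
    count_all f y c')) ->
  eventually_poly (2 * c).+1
    ((\sum_(l <- iota 1 c.+2) prim_lead f P l 1) * lead_coefficient f c)
    (correction P c.+1).
Proof.
move=> Pinv IH; rewrite /correction.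
have -> : (\sum_(l <- iota 1 c.+2) prim_lead f P l 1) * lead_coefficient f c =
  \sum_(p <- [seq (l, c') | l <- iota 1 c.+2, c' <- iota 1 c.+1])
    (if p.2 == 1%N then prim_lead f P p.1 1 * lead_coefficient f c else 0).
  rewrite big_allpairs_dep big_distrl; apply: eq_bigr => l _.
  rewrite big_cons /= big_seq big1 ?addr0 // => c'; rewrite mem_iota => c'P.
  by rewrite gtn_eqF //; lia.
apply: eventually_poly_sum => -[l c'] /allpairsPdep[l' [c'' [_ + [-> ->]]]] /=.
rewrite mem_iota add1n ltnS => /andP[c'0 c'c].
apply: (@eventually_poly_succ _ _ (fun y =>
  count_prim f P l' y c'' * count_all f (y - l') (c.+1 - c''))).
have T := count_prim_poly f1 l' c'' Pinv.
have F := eventually_poly_shift l' (IH (c.+1 - c'')%N ltac:(lia)).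
have TF := eventually_poly_mul T F.
case: eqVneq TF => [->|c'1].
  by rewrite subSS subn0 add1n.
by apply: eventually_poly_weaken; lia.
Qed.

Lemma count_all_poly c :
  eventually_poly (2 * c) (lead_coefficient f c) (fun y => count_all f y c).
Proof.
elim/ltn_ind: c => -[|c] IHc.
  rewrite /lead_coefficient expr0 fact0 divr1.
  apply: (@eventually_poly_ext _ _ (fun=> 1) _ 0); last exact: eventually_poly_const.
  by move=> y _; rewrite count_all_cost0.
have -> : lead_coefficient f c.+1 =
    (cost1_lead f * lead_coefficient f c) / (2 * c).+2%:R.
  rewrite /lead_coefficient exprS factS natrM.
  have -> : (2 * c).+2%:R = 2 * c.+1%:R :> rat by rewrite -natrM; congr _%:R; lia.
  by field; rewrite pnatr_eq0 -lt0n fact_gt0 andbT nat1r pnatr_eq0.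
rewrite mulnS add2n; apply: eventually_poly_antidifference.
(* The recursion for cost [c + 1] holds from [y = c + 1] on and gives the forward difference. *)
apply: (@eventually_poly_ext _ _ (correction predT c.+1) _ c.+1) => [y cy|].
  by rewrite /count_all count_if_rec // addrC addKr.
(* Primitive words of cost 1 have at most two gaps, so the terms with [l > 2] vanish. *)
have -> : cost1_lead f = \sum_(l <- iota 1 c.+2) prim_lead f predT l 1.
  rewrite cost1_leadE !big_cons addrA big_seq big1 ?addr0 // => l.
  by rewrite mem_iota => lP; apply: prim_lead_oversize; lia.
by apply: correction_poly => // c' c'c; apply: IHc.
Qed.

(** [P] restricts only the first primitive factor. It enters through the correction, whose degree is
    below [2c], and leaves the leading term of [count_all] unchanged. *)
Lemma count_if_poly P c : prefix_closed P -> skel_invariant P -> P [:: [::]] ->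
  eventually_poly (2 * c) (lead_coefficient f c) (fun d => count_if f P d c).
Proof.
move=> Pcat Pinv P0.
apply: (@eventually_poly_ext _ _ (fun d => count_if f P (d - 1).+1 c) _ 1) => [d d0|].
  by rewrite subn1 prednK.
apply: (@eventually_poly_shift _ _ (fun y => count_if f P y.+1 c)).
apply: (@eventually_poly_ext _ _ (fun y => count_all f y c + correction P c y) _ c) => [y cy|].
  by rewrite count_if_rec.
rewrite -[X in eventually_poly _ X]addr0; apply: eventually_poly_add.
  exact: count_all_poly.
case: c => [|c].
  apply: (@eventually_poly_ext _ _ (fun=> 0) _ 0); last exact: eventually_poly_zero.
  by move=> y _; rewrite /correction big_allpairs_dep big1 // => l _; rewrite big_nil.
apply: eventually_poly_weaken (correction_poly Pinv _); first by lia.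
by move=> c' _; apply: count_all_poly.
Qed.
End Polynomiality.

Lemma skel_lead_le (f g : nat -> rat) v : (forall w, 0 <= f w <= g w) ->
  0 <= skel_lead f v <= skel_lead g v.
Proof.
move=> fg; have c0 : 0 <= \prod_(x <- v) (size x)`!%:R^-1 :> rat.
  by apply: prodr_ge0 => x _; rewrite invr_ge0 ler0n.
rewrite /skel_lead mulr_ge0 //=; last first.
  by apply: prodr_ge0 => z _; case/andP: (fg (lwt z.2)).
by apply: ler_wpM2r => //; apply: ler_prod => z _; apply: fg.
Qed.

Lemma cost1_lead_gt0 (f : nat -> rat) : f 1%N = 1 -> (forall w, 0 <= f w) ->
  0 < cost1_lead f.
Proof.
(* A single edge of weight 1 and length 2: its contribution involves only [f 1 = 1], hence is
   positive even if [f 2 = 0]. *)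
move=> f1 f0; pose v : gap_words := [:: [:: (0, 1, 1)]; [::]]%N.
have vS : v \in cost1_skeletons.
  rewrite /cost1_skeletons mem_filter mem_cat.
  have -> : v \in skeletons 2 1.
    by rewrite mem_skeletons /v /cost /= !big_cons !big_nil.
  by rewrite orbT andbT /v !big_cons !big_nil.
rewrite /cost1_lead (big_rem v) //=; apply: ltr_wpDr.
  by apply: sumr_ge0 => u _; have /andP[] := @skel_lead_le f f u (fun w =>
    introT andP (conj (f0 w) (lexx _))).
by rewrite /skel_lead /weight /v /= !big_cons !big_nil /= f1.
Qed.

Lemma cost1_lead_lt (f g : nat -> rat) : (forall w, 0 <= f w <= g w) -> f 2%N < g 2%N ->
  cost1_lead f < cost1_lead g.
Proof.
(* A single edge of weight 2 and length 1, whose contribution is [f 2]. *)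
move=> fg fg2; pose v : gap_words := [:: [:: (0, 0, 2)]]%N.
have vS : v \in cost1_skeletons.
  rewrite /cost1_skeletons mem_filter mem_cat.
  have -> : v \in skeletons 1 1.
    by rewrite mem_skeletons /v /cost /= !big_cons !big_nil.
  by rewrite andbT /v !big_cons !big_nil.
rewrite /cost1_lead (big_rem v) // [X in _ < X](big_rem v) //=; apply: ltr_leD.
  by rewrite /skel_lead /weight /v /= !big_cons !big_nil /= !mulr1 ?invr1 ?mulr1.
by apply: ler_sum => u _; case/andP: (skel_lead_le u fg).
Qed.

(** * Words of marked floor diagrams *)

Notation strand := (nat * nat * nat)%type.

Definition span_of (z : nat * letter) : strand :=
  (z.1 - lback z.2, (z.1 + lfore z.2).+1, lwt z.2)%N.

Definition piece_of (g : nat) (x : strand) : nat * letter :=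
  (g, (g - x.1.1, x.1.2 - g.+1, x.2)%N).

Definition span_ok (d : nat) (x : strand) : bool := [&& x.1.1 < x.1.2, x.1.2 <= d & 0 < x.2]%N.

Lemma piece_ofK g x : (x.1.1 <= g < x.1.2)%N -> span_of (piece_of g x) = x.
Proof.
case: x => [[s t] w] /= gP; rewrite /span_of /piece_of /lback /lfore /lwt /=.
by congr (_, _, _); lia.
Qed.

Lemma span_ofK d z : fits d z -> piece_of z.1 (span_of z) = z.
Proof.
case: z => g [[a b] w]; rewrite /fits /span_of /piece_of /lback /lfore /lwt /= => zP.
by congr (_, (_, _, _)); lia.
Qed.

Lemma span_of_ok d z : fits d z -> span_ok d (span_of z) && ((span_of z).1.1 <= z.1 <
  (span_of z).1.2)%N.
Proof.
by case: z => g [[a b] w]; rewrite /fits /span_ok /span_of /lback /lfore /lwt /=; lia.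
Qed.

Lemma piece_of_fits d g x : span_ok d x -> (x.1.1 <= g < x.1.2)%N -> fits d (piece_of g x).
Proof.
case: x => [[s t] w]; rewrite /fits /span_ok /piece_of /lback /lfore /lwt /=; lia.
Qed.

Definition span_load (S : seq strand) (i : nat) : nat := \sum_(x <- S | (x.1.1 <= i <
  x.1.2)%N) x.2.
Definition inflow (S : seq strand) (v : nat) : nat := \sum_(x <- S | x.1.2 == v) x.2.
Definition outflow (S : seq strand) (v : nat) : nat := \sum_(x <- S | x.1.1 == v) x.2.

Lemma load_spans u i : closed u -> load u i = span_load (map span_of (place 0 u)) i.
Proof.
move=> /allP cu; rewrite /load /span_load big_map big_seq_cond [RHS]big_seq_cond.
apply: eq_bigl => z; case zu: (z \in _) => //=; have := cu _ zu.
by case: z {zu} => g [[a b] w]; rewrite /fits /covers /lback /lfore /lwt /=; lia.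
Qed.

(** Passing from gap [i] to gap [i + 1], only the strands ending or starting at vertex [i + 1]
    change. *)
Lemma span_balance d S i : all (span_ok d) S ->
  (span_load S i + outflow S i.+1 = span_load S i.+1 + inflow S i.+1)%N.
Proof.
elim: S => [|x S IHS] /=; first by rewrite /span_load /inflow /outflow !big_nil.
move=> /andP[xo /IHS]; rewrite /span_load /inflow /outflow !big_cons.
case: x xo => [[s t] w]; rewrite /span_ok /=.
by do 4 case: ifP; lia.
Qed.

Lemma span_load_end d S : all (span_ok d) S -> span_load S d = 0%N.
Proof.
move=> /allP So; rewrite /span_load big_seq_cond big_pred0 // => x.
by apply/negP => /andP[/So]; rewrite /span_ok; lia.
Qed.

(** Divergence 1 at a vertex means that the load drops by 1 there. Since nothing reaches beyond
    vertex [d], the loads follow by going backwards from 0. *)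
Lemma span_load_flow d S : all (span_ok d) S ->
  (forall i, (i < d)%N -> span_load S i = (d - i)%N) <->
  (forall i, (i < d)%N -> inflow S i.+1 = (outflow S i.+1).+1).
Proof.
move=> So; split=> [H i id|H i id].
  have := span_balance i So; rewrite H //; case: (ltngtP i.+1 d) id => // [id _|idE _].
    by rewrite H //; lia.
  by rewrite idE (span_load_end So); lia.
have Hm m : (m <= d)%N -> span_load S (d - m) = m.
  elim: m => [|m IHm] md; first by rewrite subn0 (span_load_end So).
  have lt : (d - m.+1 < d)%N by lia.
  have := span_balance (d - m.+1) So; have := H _ lt.
  have -> : (d - m.+1).+1 = (d - m)%N by lia.
  by rewrite IHm 1?ltnW // => ->; lia.
by have := Hm (d - i)%N (leq_subr _ _); rewrite subKn // ltnW.
Qed.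

(** The inverse of [place 0] on lists of letters sorted by gap. *)
Definition unplace (d : nat) (k : seq (nat * letter)) : gap_words :=
  [seq [seq z.2 | z <- k & z.1 == g] | g <- iota 0 d].

Lemma filter_eq_gt n (k : seq (nat * letter)) :
  sorted (fun z z' => z.1 <= z'.1)%N k -> all (fun z => n <= z.1)%N k ->
  [seq z <- k | z.1 == n] ++ [seq z <- k | n < z.1]%N = k.
Proof.
elim: k => [|z k IHk] //= kS /andP[nz nk].
rewrite eq_sym ltn_neqAle; case: (eqVneq n z.1) => [nE|nN] /=.
  by rewrite IHk // (path_sorted kS).
rewrite nz /=; have zk : all (fun z' => z.1 <= z'.1)%N k.
  by apply: order_path_min kS => a b c; apply: leq_trans.
have E : all (fun z' => n < z'.1)%N k.
  by apply: sub_all zk => z' zz'; rewrite (leq_trans _ zz') // ltn_neqAle nN.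
rewrite (all_filterP E) (eq_in_filter (a2 := pred0)) ?filter_pred0 // => z' /(allP E) /=.
by case: ltngtP.
Qed.

Lemma place_unplaced n d (k : seq (nat * letter)) :
  sorted (fun z z' => z.1 <= z'.1)%N k -> all (fun z => n <= z.1 < n + d)%N k ->
  place n [seq [seq z.2 | z <- k & z.1 == g] | g <- iota n d] = k.
Proof.
elim: d n k => [|d IHd] n k kS kn /=.
  by case: k kS kn => [|z k] //= _ /andP[]; lia.
rewrite -[RHS](@filter_eq_gt n) //; last by apply: sub_all kn => z /andP[].
congr (_ ++ _).
  rewrite -map_comp -[RHS]map_id; apply/eq_in_map => z; rewrite mem_filter.
  by move=> /andP[/eqP <- _]; case: z.
rewrite -[RHS](IHd n.+1).
- congr place; apply/eq_in_map => g; rewrite mem_iota => gn.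
  rewrite -filter_predI; congr map; apply: eq_filter => z /=.
  by case: eqP => //= ->; rewrite (leq_trans _ (proj1 (andP gn))).
- by apply: sorted_filter => // a b c; apply: leq_trans.
- apply/allP => z; rewrite mem_filter => /andP[nz /(allP kn)]; lia.
Qed.

Lemma place_unplace d (k : seq (nat * letter)) :
  sorted (fun z z' => z.1 <= z'.1)%N k -> all (fun z => z.1 < d)%N k ->
  place 0 (unplace d k) = k.
Proof. by move=> kS kd; apply: place_unplaced => //; apply: sub_all kd. Qed.

Lemma unplace_place d u : size u = d -> unplace d (place 0 u) = u.
Proof.
move=> ud; apply: (@eq_from_nth _ [::]); rewrite /unplace size_map size_iota // => g gd.
rewrite (nth_map 0%N) ?size_iota // nth_iota // add0n.
by rewrite place0_nth -map_comp -[RHS]map_id.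
Qed.

Lemma place_sorted n u : sorted (fun z z' : nat * letter => z.1 <= z'.1)%N (place n u).
Proof.
elim: u n => [|x u IHu] n //=.
have tr : transitive (fun z z' : nat * letter => z.1 <= z'.1)%N.
  by move=> a b c; apply: leq_trans.
rewrite (sorted_pairwise tr) pairwise_cat -!(sorted_pairwise tr) IHu andbT; apply/andP; split.
  apply/allrelP => z z' /mapP[e _ ->] /=; rewrite mem_place => /andP[+ _]; exact: ltnW.
by elim: x => [|e [|e' x] IHx] //=; rewrite leqnn.
Qed.

(* [z.1 = lback z.2] says that the edge starts at the source. *)
Definition unit_ends (u : gap_words) : bool :=
  all (fun z => (z.1 == lback z.2) ==> (lwt z.2 == 1%N)) (place 0 u).

(** An edge of [v] starts at vertex [size u > 0] at the earliest, so it does not start at the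
    source. *)
Lemma unit_ends_prefix : prefix_closed unit_ends.
Proof.
move=> u v /and3P[_ u0 _] /allP cv; rewrite /unit_ends place_cat all_cat andbC.
rewrite place_shift all_map [X in X && _](_ : _ = true) //.
apply/allP => z /cv; case: z => g [[a b] w].
by rewrite /fits /lback /lfore /lwt /= => zP; apply/implyP; lia.
Qed.

Lemma unit_ends_skel : skel_invariant unit_ends.
Proof.
move=> u; rewrite /unit_ends place_skel all_filter; apply: eq_all => z /=.
by case: eqP => [->|//] /=; rewrite implybT.
Qed.

(** The edges that do not start at the source, which are those of the floor diagram itself. *)
Definition spans (u : gap_words) : seq strand :=
  [seq span_of z | z <- place 0 u & (lback z.2 < z.1)%N].

Lemma card_ord_lt d n : (n <= d)%N -> #|[set u : 'I_d | (u < n)%N]| = n.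
Proof.
move=> nd; rewrite -sum1_card -[RHS]card_ord -sum1_card.
under eq_bigl => u do rewrite inE.
exact: esym (big_ord_widen _ (fun=> 1%N) nd).
Qed.

Lemma down_closed_card d (A : {set 'I_d}) :
  (forall u v : 'I_d, (u <= v)%N -> v \in A -> u \in A) ->
  forall v, (v \in A) = (v < #|A|)%N.
Proof.
move=> Adown v; apply/idP/idP => [vA|].
  rewrite -[X in (X <= _)%N](card_ord_lt (ltn_ord v)); apply/subset_leq_card/subsetP => u.
  by rewrite inE ltnS => /Adown; apply.
apply: contraTT => vA; rewrite -leqNgt -[X in (_ <= X)%N](card_ord_lt (ltnW (ltn_ord v))).
apply/subset_leq_card/subsetP => u uA; rewrite inE ltnNge; apply: contra vA => vu.
exact: Adown vu uA.
Qed.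

(** A complete invariant [phi] identifies the classes with its values. *)
Lemma card_equivalence_partition (T : finType) (Y : eqType) (R : rel T) (S : {set T})
    (phi : T -> Y) :
  {in S &, forall x y, R x y = (phi x == phi y)} ->
  #|equivalence_partition R S| = size (undup [seq phi x | x <- enum S]).
Proof.
move=> Rphi; pose block y := [set x in S | phi x == y].
have -> : #|equivalence_partition R S| =
    #|[seq block y | y <- undup [seq phi x | x <- enum S]]|.
  apply: eq_card => A; apply/imsetP/mapP => [[x xS ->]|[y + ->]].
    exists (phi x); first by rewrite mem_undup map_f // mem_enum.
    apply/setP => z; rewrite !inE; case zS: (z \in S) => //=.
    by rewrite Rphi // eq_sym.
  rewrite mem_undup => /mapP[x]; rewrite mem_enum => xS ->.
  exists x => //; apply/setP => z; rewrite !inE; case zS: (z \in S) => //=.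
  by rewrite Rphi // eq_sym.
rewrite -(size_map block); apply/card_uniqP.
rewrite map_inj_in_uniq ?undup_uniq // => y y'.
rewrite !mem_undup => /mapP[x]; rewrite mem_enum => xS -> _ /setP/(_ x).
by rewrite !inE xS eqxx /= => /esym/eqP.
Qed.

Definition edge_span d (e : edge d) : strand := ((src e).+1, (tgt e).+1, wt e).

(** * From a marking to its word *)

Section Markings.
Variables (d : nat) (D : floor_diagram d).

Notation black := ('I_(size D) + 'I_d)%type.
Notation bv x := (inr x : mvertex D).
Notation wv v := (white D v).

(** Vertices of [D] are shifted by one to make room for the source 0, from which the additional ends
    start. *)
Definition black_span (att : {ffun 'I_d -> 'I_d}) (x : black) : strand :=
  match x with
  | inl i => edge_span (tnth (in_tuple D) i)
  | inr k => (0, (att k).+1, 1)%N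
  end.

Definition all_blacks : seq black :=
  map inl (enum 'I_(size D)) ++ map inr (enum 'I_d).

Lemma mem_all_blacks x : x \in all_blacks.
Proof.
rewrite mem_cat; case: x => i; apply/orP.
  by left; apply: map_f; rewrite mem_enum.
by right; apply: map_f; rewrite mem_enum.
Qed.

Lemma all_blacks_uniq : uniq all_blacks.
Proof.
rewrite /all_blacks cat_uniq (map_inj_uniq inl_inj) (map_inj_uniq inr_inj).
rewrite !enum_uniq andbT /=.
by apply/hasPn => _ /mapP[k _ ->]; apply/mapP => -[].
Qed.

Lemma map_black_span att : map (black_span att) all_blacks =
  map (@edge_span d) D ++ [seq (0, (att k).+1, 1)%N | k <- enum 'I_d].
Proof.
rewrite map_cat; congr (_ ++ _); last by rewrite -map_comp.
by rewrite -[in RHS](map_tnth_enum (in_tuple D) : _ = edges D) -[LHS]map_comp -[RHS]map_comp.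
Qed.

Lemma edge_span_ok (e : edge d) : e \in edges D -> span_ok d (edge_span e).
Proof.
have /andP[/allP Do _] := valP D => /Do /andP[st w0].
by rewrite /span_ok /= ltnS st w0 ltn_ord.
Qed.

Lemma black_span_ok att x : span_ok d (black_span att x).
Proof.
case: x => [i|k]; first by rewrite /= edge_span_ok ?mem_tnth.
by rewrite /span_ok /= ltn_ord.
Qed.

Lemma mweight_in att v x :
  mweight att (wv v) (bv x) =
  if (black_span att x).1.1 == v.+1 then (black_span att x).2 else 0%N.
Proof. by case: x => i. Qed.

Lemma mweight_out att x v :
  mweight att (bv x) (wv v) =
  if (black_span att x).1.2 == v.+1 then (black_span att x).2 else 0%N.
Proof. by case: x => i. Qed.

Lemma sum_all_blacks (F : black -> nat) : (\sum_x F x = \sum_(x <- all_blacks) F x)%N.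
Proof.
rewrite big_sumType big_cat; congr (_ + _)%N; rewrite [RHS]big_map big_enum /=; exact: eq_bigl.
Qed.

Lemma sum_mweight_in att v :
  (\sum_x mweight att x (wv v))%N = inflow (map (black_span att) all_blacks) v.+1.
Proof.
rewrite big_sumType /= [X in (X + _)%N]big1 // add0n.
rewrite /inflow big_map [RHS]big_mkcond /= -[RHS]sum_all_blacks.
by apply: eq_bigr => x _; exact: (mweight_out att x v).
Qed.

Lemma sum_mweight_out att v :
  (\sum_x mweight att (wv v) x)%N = outflow (map (black_span att) all_blacks) v.+1.
Proof.
rewrite big_sumType /= [X in (X + _)%N]big1 // add0n.
rewrite /outflow big_map [RHS]big_mkcond /= -[RHS]sum_all_blacks.
by apply: eq_bigr => x _; exact: (mweight_in att v x).
Qed.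

Definition black_le (M : premarking D) : rel black := fun x y => mle M (bv x) (bv y).
(** With [g] white vertices below it, a black vertex lies between vertices [g] and [g + 1], as
    vertex 0 is the source. *)
Definition gap (M : premarking D) (x : black) : nat := #|[set v : 'I_d | mle M (wv v) (bv x)]|.
Definition black_order (M : premarking D) : seq black := sort (black_le M) all_blacks.
Definition piece (M : premarking D) (x : black) := piece_of (gap M x) (black_span M.1 x).
Definition word (M : premarking D) : seq (nat * letter) := map (piece M) (black_order M).
Definition marking_family (M : premarking D) : gap_words := unplace d (word M).

Lemma black_order_perm M : perm_eq (black_order M) all_blacks.
Proof. by rewrite perm_sort. Qed.

Lemma black_order_uniq M : uniq (black_order M).
Proof. by rewrite sort_uniq all_blacks_uniq. Qed.

Lemma mem_black_order M x : x \in black_order M.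
Proof. by rewrite mem_sort mem_all_blacks. Qed.

Section OneMarking.
Variable M : premarking D.
Hypothesis MP : is_marking M.

Lemma black_le_total : total (black_le M).
Proof. by move=> x y; apply: (marking_total MP). Qed.

Lemma black_le_antisym : antisymmetric (black_le M).
Proof. by move=> x y /(marking_antisym MP) []. Qed.

Lemma black_le_trans : transitive (black_le M).
Proof. by move=> y x z; apply: (marking_trans MP). Qed.

Lemma black_order_sorted : sorted (black_le M) (black_order M).
Proof. exact/sort_sorted/black_le_total. Qed.

Lemma mle_white_black v x : mle M (wv v) (bv x) = (v < gap M x)%N.
Proof.
rewrite /gap -down_closed_card ?inE // => u w uw; rewrite !inE.
by apply: (marking_trans MP); rewrite (marking_white MP).
Qed.

Lemma mle_black_white v x : mle M (bv x) (wv v) = (gap M x <= v)%N.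
Proof.
rewrite leqNgt -mle_white_black; apply/idP/idP => [xv|vx].
  by apply/negP => vx; have := @marking_antisym _ _ _ MP (bv x) (wv v);
    rewrite xv vx => /(_ isT).
by have := marking_total MP (bv x) (wv v); rewrite (negPf vx) orbF.
Qed.

Lemma mle_black x y :
  mle M (bv x) (bv y) = (index x (black_order M) <= index y (black_order M))%N.
Proof.
have refl : reflexive (black_le M) by move=> z; have := black_le_total z z; rewrite orbb.
apply/idP/idP => [xy|]; last first.
  by apply: (sorted_leq_index black_le_trans refl black_order_sorted); apply: mem_black_order.
rewrite leqNgt; apply/negP => yx.
have yx' : black_le M y x.
  by apply: (sorted_ltn_index black_le_trans black_order_sorted); rewrite ?mem_black_order.
have E : x = y by apply: black_le_antisym; rewrite yx' andbT.
by rewrite E ltnn in yx.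
Qed.

(** The order of a marking is compatible with the orientation, so a black vertex lies between the
    end points of its edge. *)
Lemma gap_span x : ((black_span M.1 x).1.1 <= gap M x < (black_span M.1 x).1.2)%N.
Proof.
have /and3P[st td w0] := black_span_ok M.1 x; apply/andP; split.
  case E: (black_span M.1 x).1.1 => [|s] //.
  have sd : (s < d)%N by lia.
  rewrite -[s in (s < _)%N]/(val (Ordinal sd)) -mle_white_black.
  by apply: (marking_edge MP); rewrite mweight_in E eqxx.
case E: (black_span M.1 x).1.2 => [|t]; first by rewrite E in st.
have td' : (t < d)%N by rewrite E in td.
rewrite ltnS -[t in (_ <= t)%N]/(val (Ordinal td')) -mle_black_white.
by apply: (marking_edge MP); rewrite mweight_out E eqxx.
Qed.

Lemma gap_lt x : (gap M x < d)%N.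
Proof.
have /andP[_ gt] := gap_span x; have /and3P[_ td _] := black_span_ok M.1 x.
exact: leq_trans gt td.
Qed.

Lemma gap_mono x y : black_le M x y -> (gap M x <= gap M y)%N.
Proof.
move=> xy; apply/subset_leq_card/subsetP => v; rewrite !inE => vx.
exact: (marking_trans MP) vx xy.
Qed.

Lemma place_marking_family : place 0 (marking_family M) = word M.
Proof.
apply: place_unplace.
  rewrite /word sorted_map; apply: sub_sorted black_order_sorted => x y.
  exact: gap_mono.
by apply/allP => _ /mapP[x _ ->]; apply: gap_lt.
Qed.

Lemma span_word : map span_of (word M) = map (black_span M.1) (black_order M).
Proof.
by rewrite -map_comp; apply: eq_map => x /=; rewrite piece_ofK ?gap_span.
Qed.
End OneMarking.
End Markings.

Lemma span_load_perm S S' i : perm_eq S S' -> span_load S i = span_load S' i.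
Proof. by move=> SS; apply: perm_big. Qed.

(** Lifts a rearrangement of an image to one of the source; it will assign black vertices to the
    letters of a word. *)
Lemma perm_eq_map_pull (T1 T2 : eqType) (h : T1 -> T2) (s : seq T1) (t : seq T2) :
  perm_eq (map h s) t -> exists2 s', perm_eq s' s & map h s' = t.
Proof.
elim: t s => [|y t IHt] s st.
  by exists [::] => //; case: s st => // x s /perm_size.
have : y \in map h s by rewrite (perm_mem st) mem_head.
case/mapP=> x xs yE; have sx := perm_to_rem xs.
have [|s' ps' hs'] := IHt (rem x s).
  rewrite -(perm_cons y) {1}yE -map_cons; apply: perm_trans st.
  by rewrite perm_map // perm_sym.
exists (x :: s'); last by rewrite /= -yE hs'.
by rewrite (permPr sx) perm_cons.
Qed.

(** * The word as a complete invariant of a marking *)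

Section Markings.
Variables (d : nat) (D : floor_diagram d).

Notation black := ('I_(size D) + 'I_d)%type.
Notation bv x := (inr x : mvertex D).
Notation wv v := (white D v).

Definition realizes (u : gap_words) : bool :=
  unit_ends u && perm_eq (spans u) (map (@edge_span d) D).

Lemma marking_family_spans (M : premarking D) : is_marking M ->
  perm_eq (map span_of (place 0 (marking_family M))) (map (black_span M.1) (all_blacks D)).
Proof.
by move=> MP; rewrite place_marking_family // span_word // perm_map // black_order_perm.
Qed.

Lemma marking_family_mem (M : premarking D) : is_marking M -> marking_family M \in families
  d d.
Proof.
move=> MP; have pE := place_marking_family MP.
have sz : size (marking_family M) = d by rewrite /marking_family /unplace size_map size_iota.
have cl : closed (marking_family M).
  rewrite /closed sz pE; apply/allP => _ /mapP[x _ ->].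
  by apply: piece_of_fits; [exact: black_span_ok | exact: gap_span].
rewrite mem_families /loaded sz eqxx cl /=; apply/allP => i; rewrite mem_iota add0n /= => id.
rewrite load_spans // (span_load_perm _ (marking_family_spans MP)).
apply/eqP; apply: (span_load_flow _).2 => //.
  by apply/allP => _ /mapP[x _ ->]; apply: black_span_ok.
move=> v vd; have := marking_div MP (Ordinal vd).
by rewrite sum_mweight_in sum_mweight_out /=; lia.
Qed.

Lemma filter_black_span att :
  [seq x <- map (black_span att) (all_blacks D) | (0 < x.1.1)%N] = map (@edge_span d) D.
Proof.
rewrite map_black_span filter_cat (all_filterP _); last first.
  by apply/allP => _ /mapP[e _ ->].
by rewrite (eq_in_filter (a2 := pred0)) ?filter_pred0 ?cats0 // => _ /mapP[k _ ->].
Qed.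

Lemma spans_filter u : spans u = [seq x <- map span_of (place 0 u) | (0 < x.1.1)%N].
Proof.
by rewrite /spans filter_map; congr map; apply: eq_filter => z; rewrite /= subn_gt0.
Qed.

Lemma marking_family_realizes (M : premarking D) : is_marking M -> realizes (marking_family M).
Proof.
move=> MP; apply/andP; split; last first.
  by rewrite spans_filter -(filter_black_span M.1) perm_filter // marking_family_spans.
rewrite /unit_ends place_marking_family //; apply/allP => _ /mapP[x _ ->].
have := gap_span MP x; rewrite /piece /piece_of /lback /lwt /=.
by case: x => [i|k] //= gs; apply/implyP; rewrite /= in gs *; lia.
Qed.

(** The weights at a black vertex recover its strand; start 0 is recognised by the absence of an
    edge from a white vertex. *)
Lemma black_span_inj att att' (x y : black) :
  (forall v, mweight att (wv v) (bv x) = mweight att' (wv v) (bv y)) ->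
  (forall v, mweight att (bv x) (wv v) = mweight att' (bv y) (wv v)) ->
  black_span att x = black_span att' y.
Proof.
move=> Hin Hout.
have /and3P[st td w0] := black_span_ok att x; have /and3P[st' td' w0'] := black_span_ok att' y.
have tE : (black_span att x).1.2 = (black_span att' y).1.2 /\ (black_span att x).2 =
  (black_span att' y).2.
  have lt : ((black_span att x).1.2.-1 < d)%N by lia.
  have := Hout (Ordinal lt); rewrite !mweight_out /= prednK ?(leq_ltn_trans _ st) // eqxx.
  by case: eqP => [-> ->|_ w00] //; rewrite w00 in w0.
have sE : (black_span att x).1.1 = (black_span att' y).1.1.
  case Ex: (black_span att x).1.1 => [|s].
    case Ey: (black_span att' y).1.1 => [|s'] //.
    have lt : (s' < d)%N by lia.
    have := Hin (Ordinal lt); rewrite !mweight_in Ex Ey eqxx /= => w00.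
    by rewrite -w00 in w0'.
  have lt : (s < d)%N by lia.
  have := Hin (Ordinal lt); rewrite !mweight_in Ex eqxx /=.
  by case: eqP => [-> //|_ w00]; rewrite w00 in w0.
by case: (black_span att x) (black_span att' y) tE sE => [[s t] w] [[s' t'] w'] /= [-> ->] ->.
Qed.

(** An equivalence fixes the white vertices, hence permutes the black ones. It is monotone, so it
    carries one sorted list of black vertices to the other and preserves gaps and strands. *)
Lemma marking_equiv_family (M M' : premarking D) : is_marking M -> is_marking M' ->
  marking_equiv M M' -> marking_family M = marking_family M'.
Proof.
move=> MP MP' /existsP[f /and3P[/forallP fw /forallP fm /forallP fl]].
have fb (x : black) : exists y : black, f (bv x) = bv y.
  case E: (f (bv x)) => [v|y]; last by exists y.
  have : f (bv x) = f (wv v) by rewrite E (eqP (fw v)).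
  by move/perm_inj.
pose phi x := projT1 (boolp.cid (fb x)).
have phiE x : f (bv x) = bv (phi x) by rewrite /phi; case: boolp.cid.
have phi_inj : injective phi.
  move=> x y xy; have : f (bv x) = f (bv y) by rewrite !phiE xy.
  by move=> /perm_inj [].
congr unplace; rewrite /word.
have -> : black_order M' = map phi (black_order M).
  apply: (sorted_eq (black_le_trans MP') (black_le_antisym MP')).
  - exact: black_order_sorted.
  - rewrite sorted_map; apply: sub_sorted (black_order_sorted MP) => x y.
    by rewrite /black_le /= -!phiE (eqP (forallP (fl _) _)).
  - apply: uniq_perm; rewrite ?black_order_uniq ?map_inj_uniq ?black_order_uniq // => y.
    rewrite mem_black_order; apply/esym.
    have [psi _ psiK] : bijective phi by apply: injF_bij.
    by rewrite -[y]psiK map_f // mem_black_order.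
rewrite -map_comp; apply: eq_map => x /=; rewrite /piece.
have -> : gap M x = gap M' (phi x).
  apply: eq_card => v; rewrite !inE -phiE -{2}(eqP (fw v)).
  by rewrite (eqP (forallP (fl _) _)).
congr piece_of; apply: black_span_inj => v.
  by rewrite -phiE -{2}(eqP (fw v)) (eqP (forallP (fm _) _)).
by rewrite -phiE -{2}(eqP (fw v)) (eqP (forallP (fm _) _)).
Qed.

(** The equivalence matches black vertices of equal position in the two orders; equal letters give
    equal gaps and strands, which determine weights and order. *)
Lemma family_marking_equiv (M M' : premarking D) : is_marking M -> is_marking M' ->
  marking_family M = marking_family M' -> marking_equiv M M'.
Proof.
move=> MP MP' E.
have wE : word M = word M' by rewrite -!place_marking_family // E.
have szE : size (black_order M) = size (black_order M').
  by rewrite -(size_map (piece M)) -/(word M) wE size_map.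
pose phi x := nth x (black_order M') (index x (black_order M)).
have idx_lt x : (index x (black_order M) < size (black_order M'))%N.
  by rewrite -szE index_mem mem_black_order.
have idxE x : index (phi x) (black_order M') = index x (black_order M).
  by rewrite /phi index_uniq ?black_order_uniq.
have phi_inj : injective phi.
  move=> x y xy; have : index x (black_order M) = index y (black_order M).
    by rewrite -!idxE xy.
  by move/index_inj => /(_ x (mem_black_order _ _) (mem_black_order _ _)).
have pieceE x : piece M' (phi x) = piece M x.
  have := congr1 (fun s => nth (piece M x) s (index x (black_order M))) wE.
  rewrite /word (nth_map x) ?szE // nth_index ?mem_black_order // => ->.
  by rewrite (nth_map x).
have gapE x : gap M' (phi x) = gap M x by have [] := pieceE x.
have spanE x : black_span M'.1 (phi x) = black_span M.1 x.
  by rewrite -(piece_ofK (gap_span MP x)) -(piece_ofK (gap_span MP' (phi x)));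
    congr span_of; apply: pieceE.
pose h (x : mvertex D) : mvertex D := match x with inl v => inl v | inr x => inr (phi x) end.
have h_inj : injective h.
  by move=> [v|x] [v'|x'] //= [] /phi_inj ->.
apply/existsP; exists (perm h_inj); apply/and3P; split; apply/forallP=> x; rewrite ?permE //.
  apply/forallP => y; rewrite !permE; case: x y => [v|x] [v'|y] //.
  - by rewrite [X in X == _](mweight_in M'.1 v (phi y)) [X in
    _ == X](mweight_in M.1 v y) spanE.
  - by rewrite [X in X == _](mweight_out M'.1 (phi x) v') [X in
    _ == X](mweight_out M.1 x v') spanE.
  - have bb att (a b : black) : mweight att (bv a) (bv b) = 0%N by case: a => ?; case: b.
    by rewrite [X in X == _](bb M'.1 (phi x)) [X in _ == X](bb M.1 x).
apply/forallP => y; rewrite !permE; case: x y => [v|x] [v'|y] /=.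
- by rewrite !(marking_white MP, marking_white MP').
- by rewrite [X in X == _](mle_white_black MP') [X in _ == X](mle_white_black MP) gapE.
- by rewrite [X in X == _](mle_black_white MP') [X in _ == X](mle_black_white MP) gapE.
- by rewrite (mle_black MP') (mle_black MP) !idxE.
Qed.
End Markings.

Lemma map_index_uniq (T : eqType) (s : seq T) : uniq s ->
  map (index^~ s) s = iota 0 (size s).
Proof.
case: s => [//|x0 s'] us; set s := x0 :: s' in us *.
apply: (@eq_from_nth _ 0%N); rewrite ?size_map ?size_iota // => i il.
by rewrite (nth_map x0) // index_uniq // nth_iota.
Qed.

Lemma family_spans_ok d u : u \in families d d -> all (span_ok d) (map span_of (place 0 u)).
Proof.
rewrite mem_families => /and3P[/eqP su /allP cu _]; apply/allP => _ /mapP[z /cu + ->].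
by rewrite su => /span_of_ok /andP[].
Qed.

Lemma family_span_load d u i : u \in families d d ->
  span_load (map span_of (place 0 u)) i = (d - i)%N.
Proof.
move=> ud; have So := family_spans_ok ud.
move: (ud); rewrite mem_families => /and3P[/eqP su cu /allP lu].
rewrite -load_spans //; case: (ltnP i d) => [id|di].
  by apply/eqP/lu; rewrite mem_iota.
rewrite load_spans // /span_load big_seq_cond big_pred0 => [|x]; first by lia.
by apply/negP => /andP[/(allP So)]; rewrite /span_ok; lia.
Qed.

(** Gap 0 has load [d] and is covered exactly by the edges from the source, each of weight 1; hence
    there are [d] of them. *)
Lemma end_spans d u : u \in families d d -> unit_ends u ->
  size [seq x <- map span_of (place 0 u) | (x.1.1 == 0)%N] = d /\
  {in [seq x <- map span_of (place 0 u) | (x.1.1 == 0)%N], forall x,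
     x = (0, x.1.2.-1.+1, 1)%N /\ (x.1.2.-1 < d)%N}.
Proof.
move=> ud /allP ue; have /allP So := family_spans_ok ud.
set E := [seq x <- _ | _].
have EP : {in E, forall x, x = (0, x.1.2.-1.+1, 1)%N /\ (x.1.2.-1 < d)%N}.
  move=> x; rewrite mem_filter => /andP[/eqP x0 xS]; have /and3P[st td w0] := So _ xS.
  have w1 : x.2 = 1%N.
    case/mapP: xS x0 => z zu -> /= x0; apply/eqP; apply: (implyP (ue _ zu)).
    move: ud; rewrite mem_families => /and3P[_ /allP cu _]; have := cu _ zu.
    by case: z x0 {zu} => g [[a b] w]; rewrite /fits /lback /lfore /lwt /=; lia.
  case: x x0 w1 {xS} st td w0 => [[s t] w] /= -> -> st td _.
  by rewrite prednK //; split=> //; lia.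
split=> //; have := family_span_load 0 ud; rewrite subn0 => <-.
rewrite /span_load -sum1_size /E big_filter big_seq_cond [RHS]big_seq_cond.
apply: eq_big => [x|x /andP[xS x0]].
  case xS: (x \in _) => //=; have /and3P[+ _ _] := So _ xS.
  by case: x {xS} => [[s t] w] /= st; lia.
have xE : x \in E by rewrite mem_filter x0 xS.
by have [-> _] := EP x xE.
Qed.

(** * From a word back to a marking *)

Section Realization.
Variables (d : nat) (D : floor_diagram d) (u : gap_words).
Hypotheses (ud : u \in families d d) (uD : realizes D u).

Notation black := ('I_(size D) + 'I_d)%type.
Notation bv x := (inr x : mvertex D).
Notation wv v := (white D v).
Let k := place 0 u.
Let S := map span_of k.

Lemma attachment_exists : exists att : {ffun 'I_d -> 'I_d},
  perm_eq (map (black_span att) (all_blacks D)) S.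
Proof.
have /andP[ue uS] := uD; have [szE EP] := end_spans ud ue.
set E := [seq x <- _ | _] in szE EP.
(* The [k]-th end is attached where the [k]-th strand from the source ends. The value is below [d]
   by [end_spans], so the default of [insubd] does not occur. *)
pose att := [ffun k : 'I_d => insubd k (nth (0, 1, 1)%N E k).1.2.-1].
exists att; rewrite map_black_span.
have -> : [seq (0, (att i).+1, 1)%N | i <- enum 'I_d] = E.
  have -> : E = [seq nth (0, 1, 1)%N E (val i) | i <- enum 'I_d].
    by rewrite (map_comp (nth _ E)) val_enum_ord -{1}[E](mkseq_nth (0, 1, 1)%N) szE.
  apply: eq_map => i; rewrite ffunE val_insubd.
  have iE : nth (0, 1, 1)%N E i \in E by rewrite mem_nth ?szE.
  by have [nE lt] := EP _ iE; rewrite lt -nE.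
rewrite spans_filter perm_sym in uS.
apply: (perm_trans (perm_cat uS _) (permEl (perm_filterC (fun x : strand => 0 < x.1.1)%N S))).
rewrite /E (eq_filter (a2 := predC (fun x : strand => 0 < x.1.1)%N)) ?perm_refl // => x.
by rewrite /= -eqn0Ngt.
Qed.

(** The black vertices are listed so that their strands are those of the letters of [u], and each is
    put into the gap of its letter. *)
Lemma realization : exists2 M : premarking D, is_marking M & marking_family M = u.
Proof.
have [att attS] := attachment_exists.
have [s s_perm s_span] := perm_eq_map_pull attS.
have us : uniq s by rewrite (perm_uniq s_perm) all_blacks_uniq.
have ms x : x \in s by rewrite (perm_mem s_perm) mem_all_blacks.
have szk : size k = size s by rewrite -(size_map span_of) -/S -s_span size_map.
move: (ud); rewrite mem_families => /and3P[/eqP su /allP cu _]; rewrite su -/k in cu.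
pose z0 : nat * letter := (0, (0, 0, 0))%N.
pose pos x := index x s.
have pos_lt x : (pos x < size s)%N by rewrite index_mem.
pose g x := (nth z0 k (pos x)).1.
have kfit x : fits d (nth z0 k (pos x)) by apply: cu; rewrite mem_nth ?szk.
have spanE x : span_of (nth z0 k (pos x)) = black_span att x.
  have := congr1 (fun r => nth (0, 0, 0)%N r (pos x)) s_span.
  by rewrite (nth_map x) // nth_index // /S (nth_map z0) ?szk.
have g_lt x : (g x < d)%N by have := kfit x; rewrite /fits /g; lia.
have g_span x : ((black_span att x).1.1 <= g x < (black_span att x).1.2)%N.
  by have /andP[_] := span_of_ok (kfit x); rewrite spanE.
have g_mono x y : (pos x <= pos y)%N -> (g x <= g y)%N.
  move=> xy; apply: (sorted_leq_nth (leT := fun z z' : nat * letter => z.1 <= z'.1)%N) => //.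
  - by move=> a b c; apply: leq_trans.
  - exact: place_sorted.
  - by rewrite inE szk.
  - by rewrite inE szk.
pose L := size s.
(* Lexicographic keys: gap [g] is the interval between [g * L.+1] and [g.+1 * L.+1],
   whose end points are the keys of the adjacent white vertices. *)
pose key (x : mvertex D) : nat :=
  match x with inl v => (v.+1 * L.+1)%N | inr x => (g x * L.+1 + (pos x).+1)%N end.
pose M : premarking D := (att, [set p | (key p.1 <= key p.2)%N]).
have mleE x y : mle M x y = (key x <= key y)%N by rewrite /mle inE.
have key_wb (v : 'I_d) x : (key (wv v) <= key (bv x))%N = (v < g x)%N.
  rewrite /key /=; have := pos_lt x; rewrite -/L => px.
  by apply/idP/idP => [|vg]; [apply: contraTT | ]; nia.
have key_bw (v : 'I_d) x : (key (bv x) <= key (wv v))%N = (g x <= v)%N.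
  rewrite /key /=; have := pos_lt x; rewrite -/L => px.
  by apply/idP/idP => [|vg]; [apply: contraTT | ]; nia.
have key_ww (v w : 'I_d) : (key (wv v) <= key (wv w))%N = (v <= w)%N.
  by rewrite /key /= leq_pmul2r.
have key_bb x y : (key (bv x) <= key (bv y))%N = (pos x <= pos y)%N.
  rewrite /key /=; case: (leqP (pos x) (pos y)) => xy.
    by rewrite leq_add ?leq_mul ?g_mono.
  have := g_mono _ _ (ltnW xy) => gyx; apply/negbTE; rewrite -ltnNge.
  by rewrite -addnS leq_add ?leq_mul.
have key_inj x y : (key x <= key y)%N && (key y <= key x)%N -> x = y.
  case: x y => [v|x] [w|y].
  - by rewrite (key_ww v w) (key_ww w v) -eqn_leq => /eqP/val_inj ->.
  - by rewrite (key_wb v y) (key_bw v y); lia.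
  - by rewrite (key_wb w x) (key_bw w x); lia.
  - rewrite (key_bb x y) (key_bb y x) -eqn_leq => /eqP/index_inj.
    by move=> /(_ x (ms x) (ms y)) ->.
have MP : is_marking M.
  split.
  - move=> v; rewrite sum_mweight_in sum_mweight_out /=.
    have -> : inflow (map (black_span att) (all_blacks D)) v.+1 = inflow S v.+1 by apply:
      perm_big.
    have -> : outflow (map (black_span att) (all_blacks D)) v.+1 = outflow S v.+1 by apply:
      perm_big.
    have flow := (span_load_flow (family_spans_ok ud)).1 (fun i _ => family_span_load i ud) v.
    by rewrite /S flow // -add1n PoszD addrK.
  - by move=> x y; rewrite !mleE leq_total.
  - by move=> x y; rewrite !mleE => /key_inj.
  - by move=> y x z; rewrite !mleE; apply: leq_trans.
  - by move=> v w; rewrite mleE key_ww.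
  - move=> [v|x] [w|y] //.
    + rewrite (mweight_in att v y) mleE (key_wb v y); have := g_span y.
      by case: eqP => // ->; lia.
    + rewrite (mweight_out att x w) mleE (key_bw w x); have := g_span x.
      by case: eqP => // ->; lia.
    + by case: x y => ? [].
exists M => //; rewrite /marking_family.
suff -> : word M = k by exact: unplace_place.
have -> : word M = map (piece M) s.
  congr map; apply: (sorted_eq (black_le_trans MP) (black_le_antisym MP)).
  - exact: black_order_sorted.
  - have -> : sorted (black_le M) s = sorted (relpre (index^~ s) leq) s.
      by apply: eq_sorted => x y; rewrite /black_le mleE key_bb.
    by rewrite -sorted_map map_index_uniq // iota_sorted.
  - by rewrite (perm_trans (black_order_perm M)) // perm_sym.
apply: (@eq_from_nth _ z0); rewrite size_map // => i il.
(* The list [s] has a position [i], so it is nonempty; [x0] serves as default for [nth]. *)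
have [x0 _] : exists x0 : black, true by case: s il {us ms szk s_perm s_span pos pos_lt g
  kfit spanE g_lt g_span g_mono L key M mleE key_wb key_bw key_ww key_bb key_inj MP} =>
    // x0; exists x0.
rewrite (nth_map x0) // /piece.
have pi : pos (nth x0 s i) = i by rewrite /pos index_uniq.
have -> : gap M (nth x0 s i) = g (nth x0 s i).
  rewrite /gap -[RHS](card_ord_lt (ltnW (g_lt _))); apply: eq_card => v.
  by rewrite !inE mleE key_wb.
by rewrite -spanE /g pi (span_ofK (d := d)) // -[i in nth _ _ i]pi.
Qed.
End Realization.

(** [marking_family] is a complete invariant of markings up to equivalence, and its values are
    exactly the words realizing [D]. *)
Lemma nu_families d (D : floor_diagram d) : nu D = count (realizes D) (families d d).
Proof.
rewrite /nu (card_equivalence_partition (phi := @marking_family d D)); last first.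
  move=> M M'; rewrite !inE => /boolp.asboolP MP /boolp.asboolP MP'.
  by apply/idP/eqP; [exact: marking_equiv_family | exact: family_marking_equiv].
rewrite -size_filter; apply: perm_size; apply: uniq_perm;
  rewrite ?undup_uniq ?filter_uniq ?families_uniq //.
move=> u; rewrite mem_undup mem_filter; apply/mapP/andP => [[M + ->]|[uD ud]].
  rewrite mem_enum inE => /boolp.asboolP MP.
  by rewrite marking_family_realizes // marking_family_mem.
have [M MP <-] := realization ud uD; exists M => //.
by rewrite mem_enum inE; apply/boolp.asboolP.
Qed.

(** * Multiplicities in the Grothendieck-Witt ring *)

Section GrothendieckWitt.
Variable K : fieldType.
Implicit Types (c : K) (F G : Defs.form K).

Lemma gw_of_form_isometric F G : isometric F G -> gw_of_form F = gw_of_form G.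
Proof. by rewrite /gw_of_form => /isoclassP ->. Qed.

Lemma gw_of_formM F G : gw_of_form F * gw_of_form G = gw_of_form (Defs.formM F G).
Proof.
rewrite [LHS]grothME /gw_of_form; congr gdiff; last by rewrite !(mul0r, mulr0) addr0.
by rewrite mulr0 addr0 [LHS]isoclassME.
Qed.

Lemma gw_of_formD F G : gw_of_form F + gw_of_form G = gw_of_form (Defs.formD F G).
Proof.
rewrite [LHS]grothDE /gw_of_form; congr gdiff; last by rewrite addr0.
by rewrite [LHS]isoclassDE.
Qed.

Lemma scalar_form_sym c : (c%:M : 'M[K]_1)^T = c%:M. Proof. exact: tr_scalar_mx. Qed.
Lemma scalar_form_unit c : c != 0 -> (c%:M : 'M[K]_1) \in unitmx.
Proof. by move=> c0; rewrite unitmxE det_scalar1 unitfE. Qed.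
Definition scalar_form c (c0 : c != 0) : Defs.form K := mkform (scalar_form_sym c)
  (scalar_form_unit c0).

Lemma gw_diagE c (c0 : c != 0) : gw_diag c = gw_of_form (scalar_form c0).
Proof.
rewrite /gw_diag; congr gw_of_form; apply/val_inj.
by rewrite val_insubd /is_form /= tr_scalar_mx eqxx scalar_form_unit.
Qed.

Lemma gw_diagM c c' : c != 0 -> c' != 0 -> gw_diag c * gw_diag c' = gw_diag (c * c').
Proof.
move=> c0 c'0; have cc0 : c * c' != 0 by rewrite mulf_neq0.
rewrite (gw_diagE c0) (gw_diagE c'0) (gw_diagE cc0) gw_of_formM.
apply: gw_of_form_isometric; rewrite /isometric /=.
apply: (@isom_mx_inj _ _ _ _ _ (fun=> ord0)) => // [i j _|i j].
  by apply/val_inj; case: i j => [[|i] ?] [[|j] ?].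
rewrite -(mxtens_unindexK i) -(mxtens_unindexK j) tensmxE !mxE !ord1 !eqxx.
by rewrite !mulr1n.
Qed.

(** Scaling by [c] is an isometry between [<c^2>] and [<1>]. *)
Lemma gw_diag_sqr c : c != 0 -> gw_diag c ^+ 2 = 1.
Proof.
move=> c0; have cc0 : c * c != 0 by rewrite mulf_neq0.
rewrite expr2 gw_diagM // -gw_diag1 (gw_diagE cc0) (gw_diagE (oner_neq0 K)).
apply: gw_of_form_isometric; exists c%:M, c^-1%:M.
by rewrite /= tr_scalar_mx -!scalar_mxM mulr1 mulfV // mulVf.
Qed.

Lemma gw_diag_hyp c : (2 : K) != 0 -> c != 0 -> gw_diag c + gw_diag (- c) = gw_hyp K.
Proof.
move=> two0 c0; have cN0 : - c != 0 by rewrite oppr_eq0.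
have oneN0 : - 1 != 0 :> K by rewrite oppr_eq0 oner_neq0.
rewrite /gw_hyp (gw_diagE c0) (gw_diagE cN0) (gw_diagE (oner_neq0 K)) (gw_diagE oneN0).
rewrite !gw_of_formD; apply: gw_of_form_isometric.
(* [p^2 - q^2 = c] *)
pose p := (c + 1) / 2; pose q := (c - 1) / 2.
exists (block_mx p%:M q%:M q%:M p%:M),
  (block_mx (p / c)%:M (- q / c)%:M (- q / c)%:M (p / c)%:M).
rewrite /= tr_block_mx !tr_scalar_mx !mulmx_block -!scalar_mxM !mul_mx_scalar.
rewrite ?(scaler0, mulmx0, mul0mx, addr0, add0r) -?scalar_mxM -?raddfD /=.
rewrite !(scalar_mx_block 1 1 1); split; congr block_mx; rewrite /p /q.
all: by apply/matrixP => i j; rewrite !mxE !ord1 /=; field; rewrite ?c0 ?two0.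
Qed.

Hypothesis charK0 : [pchar K] =i pred0.

Lemma natr_neq0 w : (0 < w)%N -> w%:R != 0 :> K.
Proof. by move=> w0; rewrite ((pcharf0P K).1 charK0) -lt0n. Qed.

Lemma hyp_diag c : c != 0 -> gw_hyp K * gw_diag c = gw_hyp K.
Proof.
move=> c0; rewrite [in LHS]/gw_hyp mulrDl gw_diag1 mul1r gw_diagM ?oppr_eq0 ?oner_neq0 //.
by rewrite mulN1r gw_diag_hyp // natr_neq0.
Qed.

Lemma hyp_sqr : gw_hyp K * gw_hyp K = gw_hyp K *+ 2.
Proof.
by rewrite [X in _ * X]/gw_hyp mulrDr !hyp_diag ?oppr_eq0 ?oner_neq0.
Qed.

(** The rules are [<w>^2 = 1], [H <w> = H] and [H^2 = 2H]; the second equation compares ranks. For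
    [w = 2m + 1] they give [(2m^2 + 2m) H + 1], for [w = 2m] they give [2m^2 H]. *)
Lemma edge_mult_sqr w : (0 < w)%N ->
  exists2 a, edge_mult K w ^+ 2 = gw_hyp K *+ a + (odd w)%:R & (2 * a + odd w = w ^ 2)%N.
Proof.
move=> w0; rewrite /edge_mult; have wE := odd_double_half w.
case: ifP => ow; rewrite ow in wE.
  exists (2 * w./2 ^ 2 + 2 * w./2)%N; last by rewrite -[in RHS]wE; lia.
  have -> : w.-1./2 = w./2 by rewrite -[in LHS]wE add1n doubleK.
  rewrite sqrrD gw_diag_sqr ?natr_neq0 // mulrnAl hyp_diag ?natr_neq0 //.
  congr (_ + _); rewrite expr2 mulrnAl mulrnAr hyp_sqr -!mulrnA -mulrnDr.
  by congr (_ *+ _); lia.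
exists (2 * w./2 ^ 2)%N; last by rewrite -[in RHS]wE; lia.
rewrite addr0 expr2 mulrnAl mulrnAr hyp_sqr -!mulrnA; congr (_ *+ _); lia.
Qed.

(** As [H^2 = 2H], elements [a H + o] are closed under products, and both [o] and the rank [2a + o]
    are multiplicative. *)
Lemma prod_edge_mult_sqr (I : eqType) (s : seq I) (w : I -> nat) :
  (forall i, i \in s -> (0 < w i)%N) ->
  exists2 a, \prod_(i <- s) edge_mult K (w i) ^+ 2 =
             gw_hyp K *+ a + (\prod_(i <- s) odd (w i))%N%:R &
    (2 * a + \prod_(i <- s) odd (w i) = \prod_(i <- s) w i ^ 2)%N.
Proof.
elim: s => [|i s IHs] w0; first by exists 0%N; rewrite !big_nil // mulr0n add0r.
have [|a aE a2] := IHs; first by move=> j js; rewrite w0 // inE js orbT.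
have [b bE b2] := edge_mult_sqr (w0 i (mem_head _ _)).
exists (2 * (b * a) + b * \prod_(j <- s) odd (w j) + odd (w i) * a)%N; rewrite !big_cons.
  rewrite aE bE; set o : nat := odd (w i); set p := (\prod_(j <- s) _)%N.
  rewrite mulrDl !mulrDr natrM addrA; congr (_ + _).
  rewrite mulr_natr mulr_natl [_ *+ b * _]mulrnAl [gw_hyp K * _]mulrnAr hyp_sqr.
  rewrite -!mulrnA -!mulrnDr.
  by congr (_ *+ _); lia.
by rewrite -a2 -b2; lia.
Qed.
End GrothendieckWitt.

(** * Summation over floor diagrams *)

Lemma edge_span_inj d : injective (@edge_span d).
Proof.
move=> [[s t] w] [[s' t'] w']; rewrite /edge_span /src /tgt /wt /= => -[ss tt ->].
by congr (_, _, _); apply/val_inj.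
Qed.

Lemma edge_span_surj d (S : seq strand) :
  all (fun x => span_ok d x && (0 < x.1.1)%N) S ->
  exists E : seq (edge d), map (@edge_span d) E = S.
Proof.
elim: S => [|x S IHS] /=; first by exists [::].
case: x => [[s t] w] /andP[/andP[/and3P[/= st td w0] s0] /IHS[E <-]].
have sd : (s.-1 < d)%N by lia.
have td' : (t.-1 < d)%N by lia.
exists ((Ordinal sd, Ordinal td', w) :: E); rewrite /= /edge_span /src /tgt /wt /=.
by rewrite !prednK //; lia.
Qed.

Lemma inflow_edges d (E : seq (edge d)) (v : 'I_d) :
  inflow (map (@edge_span d) E) v.+1 = (\sum_(e <- E | tgt e == v) wt e)%N.
Proof. by rewrite /inflow big_map; apply: eq_bigl => e; rewrite /= eqSS. Qed.

Lemma outflow_edges d (E : seq (edge d)) (v : 'I_d) :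
  outflow (map (@edge_span d) E) v.+1 = (\sum_(e <- E | src e == v) wt e)%N.
Proof. by rewrite /outflow big_map; apply: eq_bigl => e; rewrite /= eqSS. Qed.

Lemma card_covers d z : fits d z ->
  #|[pred i : 'I_d | covers i z]| = (lback z.2 + lfore z.2).+1.
Proof.
case: z => g [[a b] w]; rewrite /fits /lback /lfore /lwt /= => zP.
have /= := cardsID [set i : 'I_d | (i < g - a)%N] [set i : 'I_d | (i < (g + b).+1)%N].
have -> : [set i : 'I_d | (i < (g + b).+1)%N] :&: [set i : 'I_d | (i < g - a)%N] =
    [set i : 'I_d | (i < g - a)%N].
  by apply/setP => i; rewrite !inE; lia.
rewrite !card_ord_lt; [|lia|lia] => E.
have -> : #|[pred i : 'I_d | covers i (g, (a, b, w))]| =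
    #|[set i : 'I_d | (i < (g + b).+1)%N] :\: [set i : 'I_d | (i < g - a)%N]|.
  by apply: eq_card => i; rewrite !inE /covers /lback /lfore /=; lia.
by apply/eqP; rewrite -(eqn_add2l (g - a)) E; apply/eqP; lia.
Qed.

Lemma double_sum_subn d : (2 * \sum_(i < d) (d - i) = d * d.+1)%N.
Proof.
elim: d => [|d IHd]; first by rewrite big_ord0.
rewrite big_ord_recl mulnDr subn0 (eq_bigr (fun i : 'I_d => d - i)%N) ?IHd //.
by lia.
Qed.

(** * The floor diagram of a word *)

Section Families.
Variables (d : nat) (u : gap_words).
Hypotheses (ud : u \in families d d) (ue : unit_ends u).

(** Removing the edges from the source keeps the outflow at every vertex of the diagram and can only
    lower the inflow, so divergence 1 becomes divergence at most 1. *)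
Lemma spans_edges : exists E : floor_diagram d, map (@edge_span d) E = spans u.
Proof.
have So := family_spans_ok ud.
have [|E ES] := @edge_span_surj d (spans u).
  by rewrite spans_filter; apply/allP => x; rewrite mem_filter => /andP[-> /(allP So) ->].
have inE v : (inflow (spans u) v.+1 <= inflow (map span_of (place 0 u)) v.+1)%N.
  rewrite spans_filter /inflow big_filter_cond big_mkcond [X in (_ <= X)%N]big_mkcond /=.
  by apply: leq_sum => x _; case: (0 < _)%N.
have outE v : outflow (spans u) v.+1 = outflow (map span_of (place 0 u)) v.+1.
  rewrite spans_filter /outflow big_filter_cond; apply: eq_bigl => x.
  by case: (eqVneq x.1.1 v.+1) => [->|_] //=; rewrite andbF.
have flow v : is_true (v < d)%N -> _ :=
  (span_load_flow So).1 (fun i _ => family_span_load i ud) v.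
suff EP : is_floor E by exists (FloorDiagram EP).
apply/andP; split.
  apply/allP => e eE; have : edge_span e \in spans u by rewrite -ES map_f.
  rewrite spans_filter mem_filter => /andP[_ /(allP So)].
  by rewrite /span_ok /= ltnS => /and3P[-> _ ->].
apply/forallP => v; rewrite /divergence -inflow_edges -outflow_edges ES outE.
have := inE v; rewrite flow // => le; rewrite lerBlDl addrC.
by move: le; rewrite -addn1; lia.
Qed.

(** Double counting of the total load: an edge contributes length times weight, which is its cost
    plus 1, and [d] of the edges start at the source. *)
Lemma cost_size : (cost u + (size (spans u) + d) = \sum_(i < d) (d - i))%N.
Proof.
have So := family_spans_ok ud.
have [szE _] := end_spans ud ue.
move: (ud); rewrite mem_families => /and3P[/eqP su cu _].
have -> : (size (spans u) + d = size (place 0 u))%N.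
  rewrite spans_filter -{1}szE !size_filter -(size_map span_of).
  rewrite -(count_predC (fun x : strand => (0 < x.1.1)%N)); congr (_ + _)%N.
  by apply: eq_count => x /=; rewrite -eqn0Ngt.
have -> : (\sum_(i < d) (d - i) = \sum_(i < d) load u i)%N.
  by apply: eq_bigr => i _; rewrite load_spans // (family_span_load _ ud).
under [RHS]eq_bigr => i _ do rewrite /load big_mkcond /=.
rewrite /cost -sum1_size -big_split /= [RHS]exchange_big /= big_seq [RHS]big_seq.
apply: eq_bigr => z zu; have := allP cu _ zu; rewrite su => zf.
rewrite -big_mkcond /= sum_nat_const card_covers // /lcost addn1 prednK // muln_gt0.
by case/and3P: zf => _ _ ->.
Qed.

Lemma cogenus_cost (E : floor_diagram d) : size E = size (spans u) -> cogenus E = cost u.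
Proof.
move=> sE; have cs := cost_size; have := double_sum_subn d; rewrite -cs => dd.
rewrite /cogenus /genus sE.
(* The product is written as a visible multiple of 2, so that the integer division is exact. *)
have -> : (d%:Z - 1) * (d%:Z - 2) = ((cost u)%:Z + (size (spans u))%:Z - d%:Z + 1) * 2.
  have : 2 * (cost u)%:Z + 2 * (size (spans u))%:Z + 2 * d%:Z = d%:Z * d%:Z + d%:Z :> int.
    by rewrite -!PoszM -!PoszD; congr Posz; move: dd; lia.
  move=> ddZ; rewrite [RHS](_ : _ = 2 * (cost u)%:Z + 2 * (size (spans u))%:Z + 2 * d%:Z -
    4 * d%:Z + 2); last by ring.
  by rewrite ddZ; ring.
by rewrite mulzK //; ring.
Qed.

Lemma weight_spans (f : nat -> rat) : f 1%N = 1 ->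
  weight f u = \prod_(x <- spans u) f x.2.
Proof.
move=> f1; rewrite /weight /spans big_map big_filter [RHS]big_mkcond /=.
rewrite big_seq [RHS]big_seq; apply: eq_bigr => z zu; case: ltnP => // zg.
move: ud; rewrite mem_families => /and3P[_ /allP cu _]; have /and3P[az _ _] := cu _ zu.
have /implyP/(_ _)/eqP-> // := allP ue _ zu.
by rewrite eqn_leq zg az.
Qed.
End Families.

Lemma floor_count_enum (K : fieldType) (delta d : nat) :
  exists L : seq (floor_class d), [/\ uniq L,
    forall C, (C \in L) = (cogenus (repr C) == delta%:Z) &
    floor_count K delta d = \sum_(C <- L) fd_mult K (repr C) * (nu (repr C))%:R].
Proof.
have fin := finite_floor_class d delta%:Z.
exists (finmap.enum_fset
  (cardinality.fset_set (fun C : floor_class d => cogenus (repr C) = delta%:Z))).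
split; first exact: finmap.fset_uniq.
  move=> C; rewrite cardinality.in_fset_set //.
  by apply/idP/eqP; rewrite classical_sets.inE.
by rewrite /floor_count fsbigop.fsbig_finite.
Qed.

(** After exchanging the sums, a word with unit ends is realized by exactly one class, that of its
    edges away from the source. The cogenus of this class is the cost of the word. *)
Lemma sum_nu (f : nat -> rat) (delta d : nat) (L : seq (floor_class d)) :
  f 1%N = 1 -> uniq L -> (forall C, (C \in L) = (cogenus (repr C) == delta%:Z)) ->
  \sum_(C <- L) (\prod_(e <- repr C : floor_diagram d) f (wt e)) * (nu (repr C))%:R =
  count_if f unit_ends d delta.
Proof.
move=> f1 uL mL; rewrite /count_if.
have prodE (D : floor_diagram d) :
    \prod_(e <- D) f (wt e) = \prod_(x <- map (@edge_span d) D) f x.2 by rewrite big_map.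
transitivity (\sum_(C <- L) \sum_(u <- families d d | realizes (repr C) u) weight f u).
  apply: eq_bigr => C _; rewrite nu_families -sum1_count natr_sum big_distrr /=.
  rewrite big_seq_cond [RHS]big_seq_cond; apply: eq_bigr => u /and3P[ud ue uC].
  by rewrite mulr1 prodE (weight_spans ud ue f1); apply/esym/perm_big.
rewrite (exchange_big_dep (fun u => unit_ends u)) /=; last by move=> C u _ /andP[].
rewrite big_seq_cond [RHS]big_mkcondr [RHS]big_seq_cond; apply: eq_bigr => u /andP[ud ue].
have [E ES] := spans_edges ud ue.
have rE (D : floor_diagram d) : realizes D u = fd_iso E D.
  rewrite /realizes ue -ES /fd_iso; apply/idP/idP => [/(perm_map_inj (@edge_span_inj d))//|].
  exact: perm_map.
have iso_pi : fd_iso E (repr (\pi_(floor_class d)%qT E)).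
  by have := reprK (\pi_(floor_class d)%qT E) => /eqmodP /=; rewrite /fd_iso perm_sym.
have cE C : fd_iso E (repr C) -> (C == \pi_(floor_class d)%qT E).
  by move=> EC; rewrite -[C]reprK; apply/eqP/eqmodP; rewrite /= /fd_iso perm_sym.
have cogE (D : floor_diagram d) : fd_iso E D -> cogenus D = cost u.
  move=> ED; rewrite (cogenus_cost ud ue) // -ES size_map; exact/esym/perm_size.
rewrite big_mkcond /=; case: ifP => [/eqP cu|cu].
  rewrite (bigD1_seq (\pi_(floor_class d)%qT E)) //=; last by rewrite mL cogE // cu.
  rewrite rE iso_pi big1 ?addr0 // => C CE; rewrite rE; case: ifP => // /cE.
  by rewrite (negPf CE).
rewrite big_seq big1 // => C; rewrite mL rE => /eqP CL; case: ifP => // /cogE.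
by rewrite CL => -[E']; rewrite -E' eqxx in cu.
Qed.

Lemma size_top_coef (p : {poly rat}) n : (size p <= n.+1)%N -> p`_n != 0 -> (size p).-1 = n.
Proof.
move=> sp pn; suff -> : size p = n.+1 by [].
by apply/eqP; rewrite eqn_leq sp ltnNge; apply: contra pn => /leq_sizeP ->.
Qed.

Lemma lead_coefficient_lt (f g : nat -> rat) c : f 1%N = 1 -> (forall w, 0 <= f w <= g w) ->
  f 2%N < g 2%N -> (0 < c)%N -> lead_coefficient f c < lead_coefficient g c.
Proof.
move=> f1 fg fg2 c0; have f0 : 0 < cost1_lead f.
  by apply: cost1_lead_gt0 => // w; case/andP: (fg w).
rewrite /lead_coefficient ltr_pM2r ?invr_gt0 ?ltr0n ?fact_gt0 //.
rewrite ltrXn2r -?lt0n ?divr_ge0 ?(ltW f0) // ltr_pM2r ?invr_gt0 //.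
exact: cost1_lead_lt.
Qed.

(** The rank and the coefficient of [<1>] in the squared multiplicity of an edge. *)
Definition complex_weight (w : nat) : rat := (w ^ 2)%N%:R.
Definition real_weight (w : nat) : rat := (odd w)%:R.

Lemma floor_count_split (K : fieldType) (charK0 : [pchar K] =i pred0) (delta d : nat) :
  exists a b : nat, [/\ floor_count K delta d = gw_hyp K *+ a + b%:R,
    b%:R = count_if real_weight unit_ends d delta &
    (2 * a + b)%N%:R = count_if complex_weight unit_ends d delta].
Proof.
have [L [uL mL ->]] := floor_count_enum K delta d.
rewrite -(sum_nu _ uL mL) // -(sum_nu _ uL mL) // {uL mL}.
elim: L => [|C L [a [b [E bE abE]]]]; first by exists 0%N, 0%N; rewrite !big_nil mulr0n addr0.
have wt0 e : e \in edges (repr C) -> (0 < wt e)%N.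
  by have /andP[/allP Do _] := valP (repr C) => /Do /andP[].
have [a' aE ab] := prod_edge_mult_sqr charK0 wt0.
set b' := (\prod_(e <- _) _)%N in aE ab.
exists (a' * nu (repr C) + a)%N, (b' * nu (repr C) + b)%N; split.
- rewrite big_cons E /fd_mult aE mulrDl natrD natrM mulrnDr mulrnA mulr_natr.
  by rewrite addrACA.
- by rewrite big_cons -bE natrD natrM natr_prod.
- rewrite big_cons -abE.
  have -> : \prod_(e <- repr C : floor_diagram d) complex_weight (wt e) = (2 * a' + b')%N%:R.
    by rewrite ab natr_prod.
  by rewrite -natrM -natrD; congr _%:R; lia.
Qed.

Theorem theoremE (K : fieldType) (charK0 : [pchar K] =i pred0) (delta : nat) :
  exists P Q : {poly rat},
    [/\ (size P).-1 = (2 * delta)%N,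
        (size Q).-1 = (2 * delta)%N &
        exists d0 : nat, forall d : nat, (d0 <= d)%N ->
          exists a b : int,
            [/\ P.[d%:R] = a%:~R, Q.[d%:R] = b%:~R &
                floor_count K delta d = gw_hyp K *~ a + gw_diag 1 *~ b]].
Proof.
have poly f (f1 : f 1%N = 1) := count_if_poly f1 delta unit_ends_prefix unit_ends_skel
  (erefl _).
have [p [sp pn [y0 pE]]] := poly complex_weight (erefl _).
have [q [sq qn [y1 qE]]] := poly real_weight (erefl _).
have rw0 w : 0 <= real_weight w by rewrite ler0n.
(* Eventually [p] is the rank [2a + b] and [q] is [b], which gives [a] as half the difference. *)
exists (2^-1 *: (p - q)), q; split.
- have spq : (size (2^-1 *: (p - q)) <= (2 * delta).+1)%N.
    rewrite (leq_trans (size_scale_leq _ _)) // (leq_trans (size_polyD _ _)) //.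
    by rewrite geq_max sp size_polyN.
  (* For [delta = 0] the size bound suffices, since the zero polynomial and the nonzero constants
     both count as degree 0. *)
  have [d0|d0] := posnP delta; first by move: spq; rewrite d0; case: (size _) => [|[|?]].
  (* For [delta > 0] the top coefficients of [p] and [q] differ, because the two weights of an edge
     of weight 2 are 4 and 0. *)
  apply: size_top_coef => //; rewrite coefZ coefB pn qn mulf_neq0 // subr_eq0 gt_eqF //.
  apply: lead_coefficient_lt => // w; rewrite rw0 ler_nat.
  by case: w => [|w] //; case: (odd _) => //; rewrite sqrn_gt0.
- apply: size_top_coef => //; rewrite qn gt_eqF // mulr_gt0 ?invr_gt0 ?ltr0n ?fact_gt0 //.
  by rewrite exprn_gt0 // divr_gt0 ?cost1_lead_gt0.
- exists (maxn y0 y1) => d; rewrite geq_max => /andP[dy0 dy1].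
  have [a [b [-> bE abE]]] := floor_count_split charK0 delta d.
  exists a%:Z, b%:Z; rewrite -!pmulrn gw_diag1; split=> //.
  + rewrite !hornerE -pE // -qE // -bE -abE natrD natrM.
    by field.
  + by rewrite -qE // -bE.
Qed.
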